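(* (CPHD corrector for extended targets.) In the extended-target model described in the context, let $Z=Z_k$ be the measurement set and let $G_{k|k}[h]=\frac{\delta}{\delta Z}F[0,h]\big/\frac{\delta}{\delta Z}F[0,1]$ be the probability generating functional of the updated multitarget density. Let $D_{k|k}(x)=\frac{\delta}{\delta x}\frac{\delta}{\delta Z}F[0,h]\big|_{h=1}\big/\frac{\delta}{\delta Z}F[0,1]$ be the posterior intensity (PHD), a function of the state $x$, and let $G_{k|k}(x)$, with $x$ now a scalar, be the posterior cardinality probability generating function, i.e. the value of $G_{k|k}[h]$ at the constant function $h\equiv x$. Put $\bar q=p_{k|k-1}\big[1-p_D+p_DG_Z(0)\big]$. Then $D_{k|k}(x)$ and $G_{k|k}(x)$ are calculated from $D_{k|k-1}(x)$ and $G_{k|k-1}(x)$ by $$D_{k|k}(x)=\big(\zeta_{k|k-1}^{(1)}(\bar q)+\kappa\big)\big(1-p_D(x)+p_D(x)G_Z(0|x)\big)p_{k|k-1}(x)$$ $$\qquad+\sum_{\mathcal{P}\angle Z}\omega_{\mathcal{P}}\sum_{W\in\mathcal{P}}\frac1{\beta_W}\sum_{\mathcal{Q}\angle W}\alpha_{\mathcal{Q}}\,\zeta_{k|k-1}^{(|\mathcal{Q}|)}(\bar q)\sum_{V\in\mathcal{Q}}\frac{p_D(x)G_Z^{(|V|)}(0|x)}{\eta_V[0,1]}\prod_{z'\in V}\frac{p_z(z'|x)}{p_{FA}(z')}\;p_{k|k-1}(x),$$ $$G_{k|k}(x)=\frac{G_{k|k-1}(x\bar q)}{G_{k|k-1}(\bar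 q)}\cdot\frac{\sum_{\mathcal{P}\angle Z}\prod_{W\in\mathcal{P}}\Big(\zeta_{FA}^{(|W|)}(0)+\sum_{\mathcal{Q}\angle W}\alpha_{\mathcal{Q}}\,x^{|\mathcal{Q}|}\,\zeta_{k|k-1}^{(|\mathcal{Q}|)}(x\bar q)\Big)}{\sum_{\mathcal{P}\angle Z}\prod_{W\in\mathcal{P}}\beta_W},$$ where $$p_{k|k-1}(x)=\frac{D_{k|k-1}(x)}{\int D_{k|k-1}(x)\,dx},$$ $$\zeta_{FA}^{(i)}(x)=\Big(\frac{G_{FA}^{(1)}(x)}{G_{FA}(x)}\Big)^{(i-1)},\qquad \zeta_{k|k-1}^{(i)}(x)=\Big(\frac{G_{k|k-1}^{(1)}(x)}{G_{k|k-1}(x)}\Big)^{(i-1)},$$ $$\kappa=\sum_{\mathcal{P}\angle Z}\omega_{\mathcal{P}}\sum_{W\in\mathcal{P}}\frac1{\beta_W}\sum_{\mathcal{Q}\angle W}\alpha_{\mathcal{Q}}\,\zeta_{k|k-1}^{(|\mathcal{Q}|+1)}(\bar q),\qquad \omega_{\mathcal{P}}=\frac{\prod_{W\in\mathcal{P}}\beta_W}{\sum_{\mathcal{P}'\angle Z}\prod_{W\in\mathcal{P}'}\beta_W},$$ $$\beta_W=\zeta_{FA}^{(|W|)}(0)+\sum_{\mathcal{Q}\angle W}\zeta_{k|k-1}^{(|\mathcal{Q}|)}(\bar q)\,\alpha_{\mathcal{Q}},\qquad \alpha_{\mathcal{Q}}=\prod_{V\in\mathcal{Q}}\eta_V[0,1],$$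 $$\eta_V[g,h]=p_{k|k-1}\Big[h\,p_D\,G_Z^{(|V|)}(p_z[g])\prod_{z'\in V}\frac{p_z(z')}{p_{FA}(z')}\Big].$$
   Context: Set integrals: for a function $f$ of finite sets, $\int f(X)\,\delta X=\sum_{n\ge 0}\frac1{n!}\int f(\{x_1,\dots,x_n\})\,dx_1\cdots dx_n$; for a function $h$ and a finite set $X$, $h^X=\prod_{x\in X}h(x)$. For a density $p$ and a function $g$, $p[g]=\int g(y)p(y)\,dy$. Model. Targets have states $x$ in a state space; measurements $z$ lie in a measurement space. - Target-generated measurements: a detected target with state $x$ generates an i.i.d. cluster process with density $f(Z|x)=n!\,P_z(n|x)\prod_{z\in Z}p_z(z|x)$, $n=|Z|$, where $P_z(\cdot|x)$ is a cardinality distribution with probability generating function $G_Z(y|x)=\sum_n P_z(n|x)y^n$, and $p_z(\cdot|x)$ is a probability density. A target with state $x$ is detected with probability $p_D(x)$. - False alarms: an i.i.d. cluster process with density $f(Z_{FA})=n!\,P_{FA}(n)\prod_{z\in Z_{FA}}p_{FA}(z)$, $n=|Z_{FA}|$, with cardinality generating function $G_{FA}(y)=\sum_n P_{FA}(n)y^n$. - Multitarget prior (predicted density): assumed to be an i.i.d. cluster process with density $f(X)=n!\,P_{k|k-1}(n)\prod_{x\in X}p_{k|k-1}(x)$, $n=|X|$, with cardinality generating function $G_{k|k-1}(y)=\sum_n P_{k|k-1}(n)y^n$, where $p_{k|k-1}$ is the prior intensity $D_{k|k-1}$ normalized by its integral. - Given the target set $X$, the measurement sets of the different targets are independent, and false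 alarms are added (independently) to them. With $G_{FA}[g]=\int g^Z f(Z)\,\delta Z$ ($f$ the false alarm density) and $G_Z[g|x]=\int g^Zf(Z|x)\,\delta Z$, the probability generating functional of the measurements is $$G[g|X]=G_{FA}[g]\prod_{x\in X}\big(1-p_D(x)+p_D(x)G_Z[g|x]\big).$$ Define $F[g,h]=\int h^X\,G[g|X]\,f(X)\,\delta X$ with $f(X)$ the prior. Explicitly, $F[g,h]=G_{FA}(p_{FA}[g])\;G_{k|k-1}\big(p_{k|k-1}[h(1-p_D+p_DG_Z(p_z[g]))]\big)$. Notation. Arguments $x$ are omitted inside $p_{k|k-1}[\cdot]$: there $p_D$ means $p_D(x)$, $p_z(z')$ means $p_z(z'|x)$, $p_z[g]$ means $\int g(z)p_z(z|x)\,dz$, $G_Z(0)$ means $G_Z(0|x)$, and $G_Z^{(i)}(\cdot)$ means the $i$-th derivative of $y\mapsto G_Z(y|x)$; $p_{k|k-1}[\cdot]$ integrates over $x$ against $p_{k|k-1}$. A superscript $(i)$ denotes the $i$-th derivative. Thus $\zeta_{FA}^{(i)}$ and $\zeta_{k|k-1}^{(i)}$ are the $i$-th derivatives of $\log G_{FA}$ and $\log G_{k|k-1}$. The notation $\mathcal{P}\angle Z$ means that $\mathcal{P}$ ranges over all partitions of the set $Z$ into nonempty subsets, and $|\mathcal{P}|$ is the number of subsets in $\mathcal{P}$. Functional derivatives: for $Z=\{z_1,\dots,z_n\}$, $\frac{\delta}{\delta Z}F[g,h]$ is the iterated functional derivative with respect to $g$, i.e. $\frac{\partial^n}{\partial\varepsilon_1\cdots\partial\varepsilon_n}F[g+\sum_i\varepsilon_i\delta_{z_i},h]\big|_{\varepsilon=0}$,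 where $\delta_z$ is the Dirac delta at $z$; $\frac{\delta}{\delta Z}F[0,h]$ is this at $g=0$. Similarly $\frac{\delta}{\delta x}$ is the functional derivative with respect to $h$ in the direction of the Dirac delta at $x$. *)

(* Defs.v *)
From HB Require Import structures.
From mathcomp Require Import all_boot all_order all_algebra finmap.
From mathcomp Require Import all_classical all_reals all_analysis.

Set Implicit Arguments.
Unset Strict Implicit.
Unset Printing Implicit Defensive.

Import Order.TTheory GRing.Theory Num.Theory.
Import numFieldNormedType.Exports.

Local Open Scope classical_set_scope.
Local Open Scope ring_scope.

(* Generalized test functions: an ordinary function plus a finite linear
   combination of Dirac deltas,  g = reg g + \sum_i e_i * delta_(t_i)  for
   atoms g = [:: (e_1, t_1); ...; (e_n, t_n)].  Functional derivatives evaluate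
   the functionals below at such arguments. *)
Record gfun (R : realType) (T : Type) := GFun {
  reg : T -> R ;
  atoms : seq (R * T)
}.

Definition gcst (R : realType) (T : Type) (c : R) : gfun R T :=
  GFun (fun=> c) [::].

(* g + e * delta_t *)
Definition add_delta (R : realType) (T : Type) (g : gfun R T) (e : R) (t : T) :
    gfun R T :=
  GFun (reg g) ((e, t) :: atoms g).

Section functionals.
Context {R : realType} {d : measure_display} {T : measurableType d}.
Variable mu : {measure set T -> \bar R}.
Implicit Types (g : gfun R T) (f : seq T -> R).

(* \int g(t) phi(t) dt, where \int delta_s(t) phi(t) dt = phi(s). *)
Definition gint g (phi : T -> R) : R :=
  \int[mu]_t (reg g t * phi t) + \sum_(a <- atoms g) a.1 * phi a.2.

(* \int .. \int g(t_1) .. g(t_n) f({t_1, .., t_n}) dt_1 .. dt_n.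
   A function of finite sets is given on listings of its argument. *)
Fixpoint iter_gint g (n : nat) f : R :=
  match n with
  | 0 => f [::]
  | n'.+1 => gint g (fun t => iter_gint g n' (fun s => f (t :: s)))
  end.

(* The set integral \int g^X f(X) \delta X. *)
Definition set_gint g f : R :=
  limn (series (fun n => (n`!%:R)^-1 * iter_gint g n f)).

Definition iid_cluster (P : nat -> R) (p : T -> R) (s : seq T) : R :=
  (size s)`!%:R * P (size s) * \prod_(t <- s) p t.

Definition is_pdf (p : T -> R) : Prop :=
  [/\ measurable_fun setT p,
      forall t, 0 <= p t &
      (\int[mu]_t (p t)%:E = 1)%E].

(* Iterated functional derivative of Phi at g in the directions
   delta_(t_1), .., delta_(t_n): the derivatives with respect to
   e_1, .., e_n of Phi (g + \sum_i e_i * delta_(t_i)) at e = 0. *)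
Fixpoint fderiv (Phi : gfun R T -> R) (ts : seq T) (g : gfun R T) : R :=
  match ts with
  | [::] => Phi g
  | t :: ts' => derive1 (fun e : R => fderiv Phi ts' (add_delta g e t)) 0
  end.

End functionals.

Definition is_pmf (R : realType) (P : nat -> R) : Prop :=
  (forall n, 0 <= P n) /\ (series P @ \oo --> (1 : R)).

Definition pgf (R : realType) (P : nat -> R) (y : R) : R :=
  limn (pseries P y).

(* i-th derivative of log G, for 0 < i *)
Definition logderiv (R : realType) (G : R -> R) (i : nat) : R -> R :=
  derive1n i.-1 (fun y => derive1 G y / G y).

(* States live in X and measurements in Y, with reference measures mu and nu
   (dx and dz). *)
Record et_model (R : realType) (dx dz : measure_display)
    (X : measurableType dx) (Y : measurableType dz)
    (mu : {measure set X -> \bar R}) (nu : {measure set Y -> \bar R}) := EtModel {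
  pD : X -> R ;
  pD_meas : measurable_fun setT pD ;
  pD_itv : forall x, 0 <= pD x <= 1 ;
  Pz : X -> nat -> R ;
  Pz_meas : forall n, measurable_fun setT (fun x => Pz x n) ;
  Pz_pmf : forall x, is_pmf (Pz x) ;
  pz : X -> Y -> R ;
  pz_meas : measurable_fun setT (fun xz : X * Y => pz xz.1 xz.2) ;
  pz_pdf : forall x, is_pdf nu (pz x) ;
  PFA : nat -> R ;
  PFA_pmf : is_pmf PFA ;
  pFA : Y -> R ;
  pFA_pdf : is_pdf nu pFA ;
  Pprior : nat -> R ;
  Pprior_pmf : is_pmf Pprior ;
  Dprior : X -> R ;
  Dprior_meas : measurable_fun setT Dprior ;
  Dprior_ge0 : forall x, 0 <= Dprior x ;
  Dprior_mass : (0 < \int[mu]_x (Dprior x)%:E < +oo)%E ;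
  (* the integral of the intensity is the expected number of targets *)
  Dprior_card : (\int[mu]_x (Dprior x)%:E =
                 \sum_(0 <= n <oo) (n%:R * Pprior n)%:E)%E
}.

Section corrector.
Context {R : realType} {dx dz : measure_display}.
Context {X : measurableType dx} {Y : measurableType dz}.
Context {mu : {measure set X -> \bar R}} {nu : {measure set Y -> \bar R}}.
Variable M : et_model mu nu.
Implicit Types (g : gfun R Y) (h : gfun R X) (x : X).

Definition pprior x : R := Dprior M x / \int[mu]_x' Dprior M x'.

Definition GZ x : R -> R := pgf (Pz M x).
Definition GFA : R -> R := pgf (PFA M).
Definition Gprior : R -> R := pgf (Pprior M).

Definition GFA_fun g : R := set_gint nu g (iid_cluster (PFA M) (pFA M)).
Definition GZ_fun g x : R := set_gint nu g (iid_cluster (Pz M x) (pz M x)).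

(* G[g|X] *)
Definition Gmeas g (s : seq X) : R :=
  GFA_fun g * \prod_(x <- s) (1 - pD M x + pD M x * GZ_fun g x).

(* F[g,h] *)
Definition jointF g h : R :=
  set_gint mu h (fun s => Gmeas g s * iid_cluster (Pprior M) pprior s).

(* p_{k|k-1}[h * phi] *)
Definition prior_avg h (phi : X -> R) : R :=
  gint mu h (fun x => phi x * pprior x).

Definition qbar : R :=
  prior_avg (gcst X 1) (fun x => 1 - pD M x + pD M x * GZ x 0).

Definition zetaFA : nat -> R -> R := logderiv GFA.
Definition zeta : nat -> R -> R := logderiv Gprior.

Variable Z : {fset Y}.

(* delta/delta Z F[0,h] *)
Definition dF h : R :=
  fderiv (fun g => jointF g h) (enum_fset Z) (gcst Y 0).

(* G_{k|k}[h] *)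
Definition Gpost_fun h : R := dF h / dF (gcst X 1).

(* G_{k|k}(y) for a scalar y *)
Definition Gpost (y : R) : R := Gpost_fun (gcst X y).

Definition Dpost x : R := fderiv dF [:: x] (gcst X 1) / dF (gcst X 1).

(* Subsets of Z are elements of {set Z}; partition P A (finset) excludes empty
   blocks. *)
Implicit Types (V W : {set Z}) (P Q : {set {set Z}}).

Definition eta V g h : R :=
  prior_avg h (fun x =>
    pD M x * (derive1n #|V| (GZ x)) (gint nu g (pz M x)) *
    \prod_(z in V) (pz M x (val z) / pFA M (val z))).

Definition eta01 V : R := eta V (gcst Y 0) (gcst X 1).

Definition alpha Q : R := \prod_(V in Q) eta01 V.

Definition beta W : R :=
  zetaFA #|W| 0 + \sum_(Q | finset.partition Q W) zeta #|Q| qbar * alpha Q.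

Definition beta_total : R :=
  \sum_(P | finset.partition P [set: Z]%SET) \prod_(W in P) beta W.

Definition omega P : R := (\prod_(W in P) beta W) / beta_total.

Definition kappa : R :=
  \sum_(P | finset.partition P [set: Z]%SET) omega P *
    \sum_(W in P) (beta W)^-1 *
      \sum_(Q | finset.partition Q W) alpha Q * zeta #|Q|.+1 qbar.

End corrector.

(* Main.v *)
(** Restricted to g = \sum_i e_i delta_(z_i) and h constant plus deltas, F[g,h] is
    G_FA(A) * G_prior(q), where A is linear in the e_i and q is an integral over
    the state space.  If u_W denotes the iterated derivative of log F in the
    directions z in W, then dF/de_i = F u_{z_i} and du_W/de_i = u_(W + z_i), so
    that F \sum_P \prod_(W in P) u_W, summed over the partitions of the directions
    already used, reproduces itself under differentiation: a partition of z + A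
    is a partition of A with {z} added as a block or with z put into a block.
    The same recursion, applied to log G_prior(q), writes u_W as zeta_FA plus a
    sum over the partitions Q of W.  No logarithm of a possibly negative number
    is needed, since only the logarithmic derivatives G'/G occur.  Derivatives of
    q are taken under the integral sign, dominated through a Cauchy estimate at
    half the radius of convergence of G_Z.  The intensity is one more derivative,
    in the weight of a delta added to h. *)
Require Import Defs.
From HB Require Import structures.
From mathcomp Require Import all_boot all_order all_algebra finmap.
From mathcomp Require Import all_classical all_reals all_analysis.
From mathcomp Require Import measurable_realfun ring lra.

Set Implicit Arguments.
Unset Strict Implicit.
Unset Printing Implicit Defensive.

Import Order.TTheory GRing.Theory Num.Theory.
Import numFieldNormedType.Exports.

Local Open Scope classical_set_scope.
Local Open Scope ring_scope.

(** * Sums over set partitions *)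

Section PartitionSum.
Variables (T : finType) (V : nmodType).
Implicit Types (A W : {set T}) (P : {set {set T}}) (F : {set {set T}} -> V).

Lemma partition_block_notin A W P : W != finset.set0 ->
  finset.partition P (A :\: W)%SET -> W \notin P.
Proof.
move=> W0 PA; apply: contra_neqN W0 => WP.
have := partitionS PA WP.
by rewrite subsetD => /andP[_]; rewrite -setI_eq0 finset.setIid => /eqP.
Qed.

(** Deleting the block [W] is a bijection onto the partitions of [A :\: W], inverse to adding it.
    Nonemptiness of [W] guarantees that it is not yet a block there. *)
Lemma sum_partition_block A W F : W != finset.set0 -> W \subset A ->
  \sum_(P | finset.partition P A && (W \in P)) F P =
  \sum_(P | finset.partition P (A :\: W)%SET) F (W |: P)%SET.
Proof.
move=> W0 WA.
rewrite (reindex_onto (fun P => (W |: P)%SET) (fun P => (P :\ W)%SET)) /=; last first.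
  by move=> P /andP[_ WP]; rewrite finset.setD1K.
apply: eq_bigl => P; apply/idP/idP.
  move=> /andP[/andP[PA WP] /eqP <-].
  by apply: partitionD1.
move=> PA; have WP := partition_block_notin W0 PA.
rewrite finset.setU11 andbT finset.setU1K // eqxx andbT.
have -> : A = (W :|: (A :\: W))%SET.
  apply/setP => t; rewrite !inE; case: (boolP (t \in W)) => //= tW.
  by rewrite (fintype.subsetP WA).
apply: partitionU1 => //.
by rewrite -setI_eq0 finset.setIDA finset.setDIl finset.setDv finset.set0I.
Qed.

(** Double counting of the pairs of a partition and one of its blocks: the right-hand side chooses
    the block first and then partitions the rest. *)
Lemma sum_partition_pointed A (g : {set T} -> {set {set T}} -> V) :
  \sum_(P | finset.partition P A) \sum_(W in P) g W (P :\ W)%SET =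
  \sum_(W : {set T} | (W \subset A) && (W != finset.set0))
     \sum_(P | finset.partition P (A :\: W)%SET) g W P.
Proof.
rewrite (exchange_big_dep
  (fun W : {set T} => (W \subset A) && (W != finset.set0))) /=; last first.
  by move=> P W PA WP; rewrite (partitionS PA WP) (partition_neq0 PA WP).
apply: eq_bigr => W /andP[WA W0].
rewrite (sum_partition_block (fun P => g W (P :\ W)%SET)) //.
apply: eq_bigr => P PA; congr (g _ _).
by rewrite finset.setU1K // (partition_block_notin W0 PA).
Qed.

(** Partitions are sorted by the block containing [z], written [z |: W] with [W] a possibly empty
    subset of [A]. *)
Lemma sum_partition_blockU1 z A F : z \notin A ->
  \sum_(P | finset.partition P (z |: A)%SET) F P =
  \sum_(W : {set T} | W \subset A)
     \sum_(P | finset.partition P (A :\: W)%SET) F ((z |: W) |: P)%SET.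
Proof.
move=> zA.
(* Exactly one block contains [z], so the inserted inner sum has a single term; it lets the order of
   summation be exchanged. *)
have -> : \sum_(P | finset.partition P (z |: A)%SET) F P =
    \sum_(P | finset.partition P (z |: A)%SET) \sum_(W in P | z \in W) F P.
  apply: eq_bigr => P PA.
  have zP : z \in finset.cover P by rewrite (cover_partition PA) finset.setU11.
  rewrite (big_pred1 (finset.pblock P z)) // => W /=.
  apply/andP/eqP => [[WP zW]|->]; last by rewrite mem_pblock zP pblock_mem.
  by apply/esym/def_pblock => //; apply: partition_trivIset PA.
rewrite (exchange_big_dep (fun W : {set T} => (W \subset (z |: A)%SET) && (z \in W))) /=;
  last by move=> P W PA /andP[WP ->]; rewrite (partitionS PA WP).
rewrite (reindex_onto (fun W => (z |: W)%SET) (fun W => (W :\ z)%SET)) /=; last first.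
  by move=> W /andP[_ zW]; rewrite finset.setD1K.
apply: eq_big => [W|W /andP[/andP[WA _] /eqP Wz]].
  rewrite finset.setU11 andbT; apply/idP/idP.
    move=> /andP[WA /eqP Wz].
    have zW : z \notin W by rewrite -Wz finset.setD11.
    rewrite -(finset.setU1K zA) finset.subsetD1 zW andbT.
    exact: fintype.subset_trans (finset.subsetUr _ _) WA.
  move=> WA; rewrite finset.setUS // finset.setU1K ?eqxx //.
  by apply: contra zA => /(fintype.subsetP WA).
have W0 : (z |: W)%SET != finset.set0.
  by apply/finset.set0Pn; exists z; rewrite finset.setU11.
rewrite (eq_bigl (fun P => finset.partition P (z |: A)%SET && ((z |: W)%SET \in P))).
  rewrite sum_partition_block //; apply: eq_bigl => P.
  congr finset.partition; apply/setP => t; rewrite !inE.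
  by case: eqP => [->|//]; rewrite (negPf zA) andbF.
by move=> P; rewrite finset.setU11 andbT.
Qed.

(** In [sum_partition_blockU1], empty [W] makes [{z}] a block of its own; for the other [W],
    [sum_partition_pointed] read backwards turns [W] into a block of a partition of [A]. *)
Lemma sum_partitionU1 z A F : z \notin A ->
  \sum_(P | finset.partition P (z |: A)%SET) F P =
  \sum_(P | finset.partition P A)
    (F ([set z] |: P)%SET + \sum_(W in P) F ((z |: W) |: (P :\ W))%SET).
Proof.
move=> zA; rewrite sum_partition_blockU1 // (bigD1 (finset.set0 : {set T})) ?finset.sub0set //=.
rewrite finset.setU0 finset.setD0 big_split /=; congr (_ + _).
by rewrite (sum_partition_pointed A (fun W P => F ((z |: W) |: P)%SET)).
Qed.

End PartitionSum.

(** * Sums over partitions of products over blocks *)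

Section PartitionSumProduct.
Variables (R : comPzRingType) (T : finType).
Implicit Types (c : nat -> R) (u : {set T} -> R) (A W : {set T}) (P : {set {set T}}).

(** The Faà di Bruno sum: if [c k] is the k-th derivative of a function at an inner value and [u W]
    the derivative of the inner function in the directions [W], this is the derivative of the
    composite in the directions [A]. With [c] constantly 1 it gives the derivative of an
    exponential, divided by that exponential. *)
Definition partition_sum c u A : R :=
  \sum_(P | finset.partition P A) c #|P| * \prod_(W in P) u W.

(** The right-hand side has the shape of a product rule: the first term raises the order of [c], the
    second enlarges one block. It is matched below against [is_derive1_partition_sum]. *)
Lemma partition_sumU1 c u z A : z \notin A ->
  partition_sum c u (z |: A)%SET =
  \sum_(P | finset.partition P A)
    (c #|P|.+1 * u [set z]%SET * \prod_(W in P) u W +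
     c #|P| * \sum_(W in P) u (z |: W)%SET * \prod_(W' in P | W' != W) u W').
Proof.
move=> zA; rewrite /partition_sum sum_partitionU1 //; apply: eq_bigr => P PA.
(* No block of [P] contains [z], so the added block is new; this fixes the cardinality and lets its
   factor be split off. *)
have zNP W (Q : {set {set T}}) : z \in W -> Q \subset P -> W \notin Q.
  move=> zW QP; apply: contra zA => WQ.
  have WP := fintype.subsetP QP _ WQ.
  exact: (fintype.subsetP (partitionS PA WP) _ zW).
congr (_ + _).
  have zP := zNP [set z]%SET P (finset.set11 z) (fintype.subxx _).
  by rewrite cardsU1 zP add1n big_setU1 //= mulrA.
rewrite mulr_sumr; apply: eq_bigr => W WP.
have zP : (z |: W)%SET \notin (P :\ W)%SET.
  by apply: zNP; [rewrite finset.setU11 | exact: finset.subsetDl].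
rewrite cardsU1 zP (cardsD1 W P) WP big_setU1 //=; congr (_ * (_ * _)).
by apply: eq_bigl => W'; rewrite !inE andbC.
Qed.

Lemma partition_sum0 c u : partition_sum c u finset.set0 = c 0%N.
Proof.
rewrite /partition_sum (big_pred1 (finset.set0 : {set {set T}})) => [|P].
  by rewrite cards0 big_set0 mulr1.
exact: partition_set0.
Qed.

Lemma partition_sum1 c u z : partition_sum c u [set z]%SET = c 1%N * u [set z]%SET.
Proof.
have -> : [set z]%SET = (z |: finset.set0)%SET by rewrite finset.setU0.
rewrite partition_sumU1 ?finset.in_set0 // finset.setU0.
rewrite (big_pred1 (finset.set0 : {set {set T}})) => [|P]; last exact: partition_set0.
by rewrite cards0 !big_set0 mulr1 mulr0 addr0.
Qed.

End PartitionSumProduct.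

(** * Derivatives of sums over partitions *)

Section RealDerivative.
Variable R : realType.
Implicit Types (f g : R -> R) (x : R).

Lemma is_derive1_eq f x df df' :
  is_derive x 1 f df -> df = df' -> is_derive x 1 f df'.
Proof. by move=> fdf <-. Qed.

Lemma is_derive1D f g x df dg : is_derive x 1 f df -> is_derive x 1 g dg ->
  is_derive x 1 (fun e => f e + g e) (df + dg).
Proof. by move=> fdf gdg; exact: is_deriveD. Qed.

Lemma is_derive1M f g x df dg : is_derive x 1 f df -> is_derive x 1 g dg ->
  is_derive x 1 (fun e => f e * g e) (df * g x + f x * dg).
Proof.
move=> fdf gdg; have := @is_deriveM _ _ f g x 1 df dg fdf gdg.
by move/is_derive_eq; apply; rewrite addrC; congr (_ + _); exact: mulrC.
Qed.

Lemma is_derive1_comp_fun f g x df dg : is_derive (g x) 1 f df -> is_derive x 1 g dg ->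
  is_derive x 1 (fun e => f (g e)) (df * dg).
Proof. by move=> fdf gdg; have := @is_derive1_comp _ f g x df dg fdf gdg. Qed.

Lemma is_derive1_cvg f x df : is_derive x 1 f df -> f e @[e --> x] --> f x.
Proof.
move=> [fx _]; apply: differentiable_continuous.
exact/derivable1_diffP.
Qed.

Lemma is_derive1E f x df : is_derive x 1 f df -> (derive1 f) x = df.
Proof. by move=> fdf; rewrite derive1E derive_val. Qed.

Lemma near_eq_is_derive1 f g x df :
  (\near x, f x = g x) -> is_derive x 1 g df -> is_derive x 1 f df.
Proof. by move=> fg; apply: near_eq_is_derive; near do apply/esym. Unshelve. all: by end_near. Qed.

Lemma is_derive1_sum (I : Type) (r : seq I) (P : pred I) (F : I -> R -> R)
    (dF : I -> R) x :
  (forall i, P i -> is_derive x 1 (F i) (dF i)) ->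
  is_derive x 1 (fun e => \sum_(i <- r | P i) F i e) (\sum_(i <- r | P i) dF i).
Proof.
move=> FdF; elim: r => [|i r IHr].
  by rewrite big_nil; under eq_fun do rewrite big_nil; exact: is_derive_cst.
rewrite big_cons; under eq_fun do rewrite big_cons.
by case: ifP => // Pi; apply: is_derive1D => //; exact: FdF.
Qed.

(** The product rule is stated without division, so factors may vanish. As [r] is duplicate-free,
    the condition [j != i] omits a single factor. *)
Lemma is_derive1_prod (I : eqType) (r : seq I) (F : I -> R -> R)
    (dF : I -> R) x : uniq r ->
  (forall i, i \in r -> is_derive x 1 (F i) (dF i)) ->
  is_derive x 1 (fun e => \prod_(i <- r) F i e)
    (\sum_(i <- r) dF i * \prod_(j <- r | j != i) F j x).
Proof.
elim: r => [_ _|i r IHr /= /andP[ir ur] FdF].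
  by rewrite big_nil; under eq_fun do rewrite big_nil; exact: is_derive_cst.
under eq_fun do rewrite big_cons.
rewrite big_cons big_cons eqxx /=.
have -> : \prod_(j <- r | j != i) F j x = \prod_(j <- r) F j x.
  rewrite [RHS]big_seq [LHS]big_seq_cond; apply: eq_bigl => j.
  by case: (boolP (j \in r)) => //= jr; apply: contraNneq ir => <-.
have -> : \sum_(j <- r) dF j * \prod_(j0 <- i :: r | j0 != j) F j0 x =
          F i x * \sum_(j <- r) dF j * \prod_(j0 <- r | j0 != j) F j0 x.
  rewrite mulr_sumr !big_seq; apply: eq_bigr => j jr.
  rewrite big_cons; case: eqP => [ij|_]; first by rewrite ij jr in ir.
  by rewrite /= mulrCA.
apply: is_derive1M; first by apply: FdF; rewrite inE eqxx.
by apply: IHr => // j jr; apply: FdF; rewrite inE jr orbT.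
Qed.

Lemma is_derive1_prod_set (T : finType) (A : {set T}) (F : T -> R -> R)
    (dF : T -> R) x :
  (forall i, i \in A -> is_derive x 1 (F i) (dF i)) ->
  is_derive x 1 (fun e => \prod_(i in A) F i e)
    (\sum_(i in A) dF i * \prod_(j in A | j != i) F j x).
Proof.
move=> FdF.
have -> : (fun e => \prod_(i in A) F i e) = (fun e => \prod_(i <- enum A) F i e).
  by apply/funext => e; rewrite big_enum.
have -> : \sum_(i in A) dF i * \prod_(j in A | j != i) F j x =
    \sum_(i <- enum A) dF i * \prod_(j <- enum A | j != i) F j x.
  rewrite big_enum /=; apply: eq_bigr => i _; rewrite big_enum_cond.
  by [].
apply: is_derive1_prod; first exact: enum_uniq.
by move=> i; rewrite mem_enum; exact: FdF.
Qed.

(** Differentiability of [c k] is asked only for sizes of partitions of [A]. For nonempty [A] this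
    leaves out [k = 0], where the logarithmic derivatives used for [c] have no meaningful value. *)
Lemma is_derive1_partition_sum (T : finType) (A : {set T})
    (c : nat -> R -> R) (dc : nat -> R)
    (u : {set T} -> R -> R) (du : {set T} -> R) x :
  (forall P : {set {set T}}, finset.partition P A ->
     is_derive x 1 (c #|P|) (dc #|P|)) ->
  (forall W, W != finset.set0 -> W \subset A -> is_derive x 1 (u W) (du W)) ->
  is_derive x 1 (fun e => partition_sum (c ^~ e) (u ^~ e) A)
    (\sum_(P : {set {set T}} | finset.partition P A)
      (dc #|P| * \prod_(W in P) u W x +
       c #|P| x * \sum_(W in P) du W * \prod_(W' in P | W' != W) u W' x)).
Proof.
move=> cdc udu; apply: is_derive1_sum => P PA; apply: is_derive1M; first exact: cdc.
apply: is_derive1_prod_set => W WP; apply: udu.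
  exact: partition_neq0 PA WP.
exact: partitionS PA WP.
Qed.

End RealDerivative.

(** * Smooth functions and logarithmic derivatives *)

Section Smooth.
Variable R : realType.
Implicit Types (f g : R -> R) (U : set R).

Fixpoint smooth_upto n U f : Prop :=
  if n is n'.+1 then (forall x, U x -> derivable f x 1) /\ smooth_upto n' U (derive1 f)
  else True.

Definition smooth_on U f := forall n, smooth_upto n U f.

(** On an open set, equality on [U] is equality near each point of [U], so derivatives agree there.
    The rules below need this because the formulas for [derive1] are known only on [U]. *)
Lemma smooth_upto_eq n U f g : open U -> {in U, f =1 g} ->
  smooth_upto n U f -> smooth_upto n U g.
Proof.
move=> oU; elim: n f g => [//|n IHn] f g fg /= [df sf].
have fgn x : U x -> \near x, f x = g x.
  by move=> Ux; near=> y; apply: fg; rewrite inE; near: y; exact: open_nbhs_nbhs.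
split.
  move=> x Ux; apply: (near_eq_derivable (f := f)) (df x Ux) => //.
  exact: fgn.
apply: IHn sf => x; rewrite inE => Ux; rewrite !derive1E.
by apply: near_eq_derive; exact: fgn.
Unshelve. all: by end_near. Qed.

Lemma smooth_uptoS n U f : smooth_upto n.+1 U f -> smooth_upto n U f.
Proof. by elim: n f => [//|n IHn] f /= [df sf]; split => //; exact: IHn. Qed.

Lemma smooth_uptoD n U f g : open U ->
  smooth_upto n U f -> smooth_upto n U g -> smooth_upto n U (fun x => f x + g x).
Proof.
move=> oU; elim: n f g => [//|n IHn] f g /= [df sf] [dg sg]; split.
  by move=> x Ux; apply: derivableD; [exact: df|exact: dg].
apply: smooth_upto_eq (IHn _ _ sf sg) => // x; rewrite inE => Ux.
by rewrite !derive1E deriveD //; [exact: df|exact: dg].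
Qed.

Lemma smooth_uptoN n U f : open U ->
  smooth_upto n U f -> smooth_upto n U (fun x => - f x).
Proof.
move=> oU; elim: n f => [//|n IHn] f /= [df sf]; split.
  by move=> x Ux; apply: derivableN; exact: df.
apply: smooth_upto_eq (IHn _ sf) => // x; rewrite inE => Ux.
by rewrite !derive1E deriveN //; exact: df.
Qed.

Lemma smooth_uptoM n U f g : open U ->
  smooth_upto n U f -> smooth_upto n U g -> smooth_upto n U (fun x => f x * g x).
Proof.
move=> oU; elim: n f g => [//|n IHn] f g /[dup] sf1 /= [df sf] /[dup] sg1 /= [dg sg]; split.
  by move=> x Ux; apply: derivableM; [exact: df|exact: dg].
have := smooth_uptoD oU (IHn _ _ sf (smooth_uptoS sg1)) (IHn _ _ (smooth_uptoS sf1) sg).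
apply: smooth_upto_eq => // x; rewrite inE => Ux.
rewrite !derive1E; apply/esym/derive_val.
by apply: is_derive1M; apply/derivableP; [exact: df|exact: dg].
Qed.

Lemma is_derive1V f x df : f x != 0 -> is_derive x 1 f df ->
  is_derive x 1 (fun e => (f e)^-1) (- (df * ((f x)^-1 * (f x)^-1))).
Proof.
move=> fx0 [dfx dfE].
have := @deriveV _ _ f x 1 fx0 dfx; have := @derivableV _ _ f x 1 fx0 dfx.
move=> dV VE; apply: DeriveDef; first exact: dV.
rewrite [LHS]VE dfE -[LHS]/(- f x ^- 2 * df) mulNr -exprVn expr2; congr (- _); exact: mulrC.
Qed.

(** The derivative of the inverse is [- f' / f ^ 2], which involves the inverse itself only to the
    lower order given by induction. *)
Lemma smooth_uptoV n U f : open U -> (forall x, U x -> f x != 0) ->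
  smooth_upto n U f -> smooth_upto n U (fun x => (f x)^-1).
Proof.
move=> oU f0; elim: n => [//|n IHn] /[dup] sf1 /= [df sf]; split.
  move=> x Ux.
  by have [] := is_derive1V (f0 x Ux) (derivableP (df x Ux)).
have sV := IHn (smooth_uptoS sf1).
have := smooth_uptoN oU (smooth_uptoM oU sf (smooth_uptoM oU sV sV)).
apply: smooth_upto_eq => // x; rewrite inE => Ux.
rewrite !derive1E; apply/esym/derive_val.
exact: is_derive1V (f0 x Ux) (derivableP (df x Ux)).
Qed.

Lemma smooth_on_derive1n k U f : smooth_on U f -> smooth_on U (derive1n k f).
Proof.
elim: k f => [//|k IHk] f sf; rewrite derive1Sn; apply: IHk => n.
by have [] := sf n.+1.
Qed.

Lemma smooth_on_is_derive U f x : smooth_on U f -> U x -> is_derive x 1 f ((derive1 f) x).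
Proof. by move=> /(_ 1%N)[df _] Ux; rewrite derive1E; apply/derivableP/df. Qed.

Lemma smooth_on_logderiv G U : open U -> (forall x, U x -> G x != 0) ->
  smooth_on U G -> smooth_on U (fun y => derive1 G y / G y).
Proof.
move=> oU G0 sG n; apply: smooth_uptoM => //; last exact: smooth_uptoV.
exact: (smooth_on_derive1n 1 sG).
Qed.

Lemma smooth_on_subset U U' f : open U' -> U' `<=` U -> smooth_on U f -> smooth_on U' f.
Proof.
move=> oU' UU' sf n; have := sf n; elim: n f {sf} => [//|n IHn] f /= [df sf].
by split; [move=> x /UU'; exact: df|exact: IHn].
Qed.

(** The case [i = 0] is excluded because of the truncated [i.-1]: orders 0 and 1 of [logderiv] are
    the same function. *)
Lemma is_derive1_logderiv G U i x : open U -> smooth_on U G -> U x -> G x != 0 ->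
  (0 < i)%N -> is_derive x 1 (logderiv G i) (logderiv G i.+1 x).
Proof.
move=> oU sG Ux Gx0; case: i => // i _.
(* [G] is nonzero only at [x] by hypothesis; continuity makes this set an open neighbourhood of [x]
   on which the quotient is smooth. *)
pose U' := U `&` [set y | G y != 0].
have cG y : U y -> {for y, continuous G}.
  by move=> Uy; apply: is_derive1_cvg (smooth_on_is_derive sG Uy).
have oU' : open U'.
  rewrite openE => y [Uy Gy0]; apply: filterI; first exact: open_nbhs_nbhs.
  by apply: (cvgr_neq0 _ (cG y Uy)).
have sG' : smooth_on U' G by apply: smooth_on_subset sG => // y [].
have sl : smooth_on U' (fun y => derive1 G y / G y).
  by apply: smooth_on_logderiv => // y [].
have := smooth_on_is_derive (smooth_on_derive1n i sl) (conj Ux Gx0 : U' x).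
exact.
Qed.

End Smooth.

(** * Power series *)

Section PowerSeries.
Variable R : realType.
Implicit Types (c P : nat -> R) (rho x y S : R).

Definition cvg_in_disc c rho := forall x, `|x| < rho -> cvgn (pseries c x).

Lemma cvg_in_disc_pseries c x : cvgn (pseries c x) -> cvg_in_disc c `|x|.
Proof. by move=> cx y yx; exact: is_cvg_pseries_inside cx yx. Qed.

(** The factor [n.+1] gained by differentiation is absorbed by a geometric sequence on passing to a
    slightly larger radius. *)
Lemma pseries_diffs_cvg_in_disc c rho :
  cvg_in_disc c rho -> cvg_in_disc (pseries_diffs c) rho.
Proof.
move=> crho x xrho.
(* Two radii with [|x| < t < K < rho]: convergence at [K] yields absolute convergence at [t], and
   [t] leaves the ratio [s = |x| / t] below 1. *)
pose K := (`|x| + rho) / 2; pose t := (`|x| + K) / 2.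
have x0 : 0 <= `|x| := normr_ge0 x.
have xt : `|x| < t by rewrite /t /K; lra.
have tK : t < K by rewrite /t /K; lra.
have Krho : K < rho by rewrite /K; lra.
have t0 : 0 < t by lra.
have cK : cvgn (pseries c K) by apply: crho; rewrite gtr0_norm //; lra.
have ct : cvgn (pseries (fun i => `|c i|) t).
  by apply: is_cvg_pseries_inside_norm cK _; rewrite !gtr0_norm //; lra.
pose s := `|x| / t.
have s0 : 0 <= s by rewrite divr_ge0 // ltW.
have s1 : s < 1 by rewrite ltr_pdivrMr // mul1r.
(* Each of the [n.+1] terms of the geometric sum up to [s ^+ n] is at least [s ^+ n]. *)
have bern n : n.+1%:R * s ^+ n <= (1 - s)^-1.
  rewrite -[leRHS]mul1r ler_pdivlMr ?subr_gt0 // -mulrA [_ * (1 - s)]mulrC mulrCA.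
  apply: (@le_trans _ _ ((1 - s) * \sum_(i < n.+1) s ^+ i)).
    rewrite ler_wpM2l ?subr_ge0 ?(ltW s1) // mulr_natl.
    rewrite -[X in s ^+ n *+ X](subn0 n.+1) -sumr_const_nat big_mkord.
    by apply: ler_sum => i _; apply: ler_wiXn2l => //; [exact: ltW|rewrite -ltnS].
  have := subrX1 s n.+1; rewrite -[_ - 1]opprB -[s - 1]opprB mulNr => /oppr_inj <-.
  by rewrite lerBlDr lerDl exprn_ge0.
apply: normed_cvg.
apply: (@series_le_cvg _ _ (fun n => ((1 - s)^-1 / t) * (`|c n.+1| * t ^+ n.+1))) => [n|n|n|].
- exact: normr_ge0.
- by rewrite !mulr_ge0 ?invr_ge0 ?subr_ge0 ?exprn_ge0 // ?ltW.
- rewrite /= /pseries_diffs !normrM normrX ger0_norm //.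
  have -> : `|x| = s * t by rewrite divfK // gt_eqF.
  rewrite exprMn.
  have -> : n.+1%:R * `|c n.+1| * (s ^+ n * t ^+ n) =
      n.+1%:R * s ^+ n * (`|c n.+1| * t ^+ n) by ring.
  have -> : (1 - s)^-1 / t * (`|c n.+1| * t ^+ n.+1) =
      (1 - s)^-1 * (`|c n.+1| * t ^+ n).
    by rewrite exprS; field; rewrite subr_eq0 !gt_eqF.
  by rewrite ler_wpM2r // mulr_ge0 // exprn_ge0 // ltW.
have := @is_cvg_seriesZ _ (fun n => `|c n.+1| * t ^+ n.+1) ((1 - s)^-1 / t).
apply.
have := ct; rewrite /pseries -(is_cvg_series_restrict 1) => ct1.
have -> : series (fun n => `|c n.+1| * t ^+ n.+1) =
    [sequence \sum_(1 <= k < n.+1) `|c k| * t ^+ k]_n.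
  by apply/funext => n; rewrite /series /= big_add1.
by move/cvg_ex: ct1 => [l ul]; apply/cvg_ex; exists l;
  rewrite (cvg_shiftS (fun n => \sum_(1 <= k < n) `|c k| * t ^+ k) (nbhs l)).
Qed.

Lemma is_derive1_pgf c rho x : cvg_in_disc c rho -> `|x| < rho ->
  is_derive x 1 (pgf c) (pgf (pseries_diffs c) x).
Proof.
move=> crho xrho; pose K := (`|x| + rho) / 2.
have x0 : 0 <= `|x| := normr_ge0 x.
have K0 : 0 <= K by rewrite /K; lra.
have Krho : `|K| < rho by rewrite ger0_norm // /K; lra.
have c1 := pseries_diffs_cvg_in_disc crho.
have c2 := pseries_diffs_cvg_in_disc c1.
apply: (@pseries_snd_diffs _ c K); [exact: crho|exact: c1|exact: c2|].
by rewrite (ger0_norm K0) /K; lra.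
Qed.

Lemma open_disc rho : open [set x : R | `|x| < rho].
Proof.
have -> : [set x : R | `|x| < rho] = ball (0 : R) rho.
  by apply/seteqP; split => x; rewrite /ball /= sub0r normrN.
exact: ball_open.
Qed.

Lemma smooth_on_pgf c rho : cvg_in_disc c rho ->
  smooth_on [set x | `|x| < rho] (pgf c).
Proof.
move=> crho n; elim: n c crho => [//|n IHn] c crho; split.
  by move=> x /= xrho; have [] := is_derive1_pgf crho xrho.
apply: smooth_upto_eq (IHn _ (pseries_diffs_cvg_in_disc crho)).
  exact: open_disc.
by move=> x; rewrite inE => xrho; apply/esym/is_derive1E/is_derive1_pgf/xrho.
Qed.

Lemma iter_pseries_diffs_cvg_in_disc c rho k :
  cvg_in_disc c rho -> cvg_in_disc (iter k (@pseries_diffs R) c) rho.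
Proof.
by move=> crho; elim: k => //= k IHk; exact: pseries_diffs_cvg_in_disc.
Qed.

Lemma derive1n_pgf c rho k x : cvg_in_disc c rho -> `|x| < rho ->
  derive1n k (pgf c) x = pgf (iter k (@pseries_diffs R) c) x.
Proof.
move=> crho; elim: k x => [//|k IHk] x xrho.
rewrite derive1nS; apply: is_derive1E.
apply: near_eq_is_derive1 (is_derive1_pgf _ xrho); last first.
  exact: iter_pseries_diffs_cvg_in_disc.
have nx : nbhs x [set y | `|y| < rho].
  by apply: open_nbhs_nbhs; split => //; exact: open_disc.
by near=> y; apply: IHk; near: y.
Unshelve. all: by end_near. Qed.

Lemma iter_pseries_diffsE c k n :
  iter k (@pseries_diffs R) c n = ((n + k) ^_ k)%:R * c (n + k)%N.
Proof.
elim: k n => [|k IHk] n; first by rewrite addn0 ffactn0 mul1r.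
rewrite iterS /pseries_diffs IHk addSnnS mulrA -natrM; congr (_%:R * _).
by rewrite ffactnSr -addSnnS addnK mulnC.
Qed.

(** A binomial coefficient is at most [2 ^ n]; halving the radius of convergence later compensates
    for this power of 2. *)
Lemma ffact_le_fact_exp2 n k : (n ^_ k <= k`! * 2 ^ n)%N.
Proof.
rewrite -bin_ffact mulnC leq_mul2l; apply/orP; right.
elim: n k => [|n IHn] [|k]; rewrite ?bin0 ?bin0n ?expn_gt0 //.
by rewrite binS expnS mul2n -addnn leq_add.
Qed.

Lemma pgf_ge_partial P x n : (forall k, 0 <= P k) -> 0 <= x ->
  cvgn (pseries P x) -> \sum_(0 <= i < n) P i * x ^+ i <= pgf P x.
Proof.
move=> P0 x0 Px; apply: (nondecreasing_cvgn_le _ Px).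
by apply: nondecreasing_series => k _ _; rewrite mulr_ge0 // exprn_ge0.
Qed.

Lemma pgf_ge0 P x : (forall k, 0 <= P k) -> 0 <= x ->
  cvgn (pseries P x) -> 0 <= pgf P x.
Proof.
by move=> P0 x0 Px; have := pgf_ge_partial 0 P0 x0 Px; rewrite big_nil.
Qed.

Lemma pgf_bound c x (B : R) : cvgn (pseries c x) ->
  (forall n, `|\sum_(0 <= i < n) c i * x ^+ i| <= B) -> `|pgf c x| <= B.
Proof.
move=> cx bnd; rewrite /pgf -lim_norm //; apply: limr_le.
  exact: is_cvg_norm.
by near=> n; exact: bnd.
Unshelve. all: by end_near. Qed.

(* A Cauchy estimate at half the radius [del * S]; it is uniform in [S],
   which makes it usable as a dominating function of the state. *)
Lemma pgf_derive_bound P k del S x :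
  (forall n, 0 <= P n) -> 0 < del -> 0 <= S ->
  cvgn (pseries P (del * S)) -> `|x| <= del / 2 * S ->
  cvgn (pseries (iter k (@pseries_diffs R) P) x) ->
  `|pgf (iter k (@pseries_diffs R) P) x| * S ^+ k <=
  k`!%:R * (2 / del) ^+ k * pgf P (del * S).
Proof.
move=> P0 del0 S0 PdS xS cx.
have dS0 : 0 <= del * S by rewrite mulr_ge0 // ltW.
have C0 : 0 <= k`!%:R * (2 / del) ^+ k.
  by rewrite mulr_ge0 // exprn_ge0 // divr_ge0 // ltW.
have [->|Sk0] := eqVneq (S ^+ k) 0; first by rewrite mulr0 mulr_ge0 // pgf_ge0.
have Sk : 0 < S ^+ k by rewrite lt_def Sk0 exprn_ge0.
rewrite -ler_pdivlMr //; apply: pgf_bound => // n.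
rewrite ler_pdivlMr // (le_trans (ler_wpM2r (ltW Sk) (ler_norm_sum _ _ _))) //.
(* The derived series is compared termwise with the terms of index at least [k] of the original
   series at [del * S], whose partial sums are at most [pgf P (del * S)]. *)
apply: le_trans (_ : _ <= k`!%:R * (2 / del) ^+ k *
   \sum_(0 <= i < n) P (i + k)%N * (del * S) ^+ (i + k)) _; last first.
  rewrite ler_wpM2l //; apply: le_trans (pgf_ge_partial (n + k) P0 dS0 PdS).
  have -> : \sum_(0 <= i < n) P (i + k)%N * (del * S) ^+ (i + k) =
      \sum_(k <= i < n + k) P i * (del * S) ^+ i.
    have := big_addn 0 (n + k) k xpredT (fun i => P i * (del * S) ^+ i).
    by rewrite add0n addnK => ->.
  rewrite [leRHS](@big_cat_nat _ _ _ k) ?leq_addl //= lerDr.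
  by apply: sumr_ge0 => i _; rewrite mulr_ge0 // exprn_ge0.
rewrite mulr_suml mulr_sumr; apply: ler_sum => i _.
rewrite iter_pseries_diffsE !normrM normrX normr_nat (ger0_norm (P0 _)) [(del * S) ^+ _]exprMn.
have -> : k`!%:R * (2 / del) ^+ k * (P (i + k)%N * (del ^+ (i + k) * S ^+ (i + k))) =
   (k`! * 2 ^ (i + k))%:R * P (i + k)%N * (del / 2 * S) ^+ i * S ^+ k.
  rewrite natrM natrX !exprMn !exprVn !exprD; field.
  by rewrite !expf_neq0 ?gt_eqF.
rewrite ler_wpM2r ?(ltW Sk) // ler_pM ?mulr_ge0 ?exprn_ge0 //.
  by rewrite ler_wpM2r // ler_nat ffact_le_fact_exp2.
by rewrite lerXn2r // nnegrE ?normr_ge0 // mulr_ge0 ?divr_ge0 // ltW.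
Qed.

Lemma measurable_pgf d (T : measurableType d) (c : T -> nat -> R) (s : T -> R) k :
  (forall n, measurable_fun setT (c ^~ n)) -> measurable_fun setT s ->
  (forall t, cvgn (pseries (iter k (@pseries_diffs R) (c t)) (s t))) ->
  measurable_fun setT (fun t => pgf (iter k (@pseries_diffs R) (c t)) (s t)).
Proof.
move=> mc ms cs.
apply: (@measurable_fun_cvg _ _ _ _
  (fun n t => pseries (iter k (@pseries_diffs R) (c t)) (s t) n)) => [n|t _]; last first.
  exact: cs.
apply: measurable_sum => i.
under eq_fun => t do rewrite /= iter_pseries_diffsE.
apply: measurable_funM; last exact: measurable_funX.
by apply: measurable_funM => //; exact: measurable_cst.
Qed.

Lemma pmf_cvg_in_disc P : is_pmf P -> cvg_in_disc P 1.
Proof.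
move=> [_ P1]; rewrite -(normr1 R); apply: cvg_in_disc_pseries.
rewrite /pseries; under eq_fun do rewrite expr1n mulr1.
by apply/cvg_ex; exists 1.
Qed.

End PowerSeries.

(** * The joint functional at combinations of deltas *)

Section GeneralizedIntegral.
Context {R : realType} {d : measure_display} {T : measurableType d}.
Variable mu : {measure set T -> \bar R}.
Implicit Types (g : gfun R T) (phi w : T -> R).

Lemma gintZ g c phi :
  mu.-integrable setT (fun t => (reg g t * phi t)%:E) ->
  gint mu g (fun t => c * phi t) = c * gint mu g phi.
Proof.
move=> iphi; rewrite /gint mulrDr; congr (_ + _).
  rewrite -RintegralZl //; apply: eq_Rintegral => t _; exact: mulrCA.
by rewrite mulr_sumr; apply: eq_bigr => a _; exact: mulrCA.
Qed.

(** The constant [c] varies in the induction, where it absorbs the factor [w t] of the outer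
    variable. Fixing the size of [s] lets [c] contain the cardinality weight of a cluster
    density. *)
Lemma iter_gint_prod g n f c w :
  mu.-integrable setT (fun t => (reg g t * w t)%:E) ->
  (forall s, size s = n -> f s = c * \prod_(t <- s) w t) ->
  iter_gint mu g n f = c * gint mu g w ^+ n.
Proof.
move=> iw; elim: n f c => [|n IHn] f c fE /=; first by rewrite fE // big_nil.
have -> : (fun t => iter_gint mu g n (fun s => f (t :: s))) =
    (fun t => c * gint mu g w ^+ n * w t).
  apply/funext => t; rewrite (IHn _ (c * w t)) => [|s sn]; first by rewrite mulrAC.
  by rewrite fE /= ?sn // big_cons mulrA.
by rewrite gintZ // exprSr mulrA.
Qed.

End GeneralizedIntegral.

(** * Linear forms in the weights of the deltas *)

Section LinearForm.
Variables (R : realType) (T : finType).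
Implicit Types (l : seq (R * T)) (c : T -> R).

Definition lin_form l c : R := \sum_(p <- l) p.1 * c p.2.

Definition l1_norm l : R := \sum_(p <- l) `|p.1|.

Lemma lin_form_cons (e : R) z l c : lin_form ((e, z) :: l) c = e * c z + lin_form l c.
Proof. by rewrite /lin_form big_cons. Qed.

Lemma l1_norm_cons e z l : l1_norm ((e, z) :: l) = `|e| + l1_norm l.
Proof. by rewrite /l1_norm big_cons. Qed.

Lemma lin_form0 z l c : lin_form ((0, z) :: l) c = lin_form l c.
Proof. by rewrite lin_form_cons mul0r add0r. Qed.

(** Each coefficient is bounded by the total, which separates the weights in [l] from the
    state-dependent sum. *)
Lemma lin_form_le l c : (forall z, 0 <= c z) ->
  `|lin_form l c| <= l1_norm l * \sum_z c z.
Proof.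
move=> c0; rewrite mulr_suml (le_trans (ler_norm_sum _ _ _)) //.
apply: ler_sum => p _; rewrite normrM (ger0_norm (c0 _)) ler_wpM2l //.
by rewrite (bigD1 p.2) //= lerDl sumr_ge0.
Qed.

Lemma is_derive1_lin_form l c z (e : R) :
  is_derive e 1 (fun e => lin_form ((e, z) :: l) c) (c z).
Proof.
under eq_fun do rewrite lin_form_cons.
have D := is_derive1D (is_derive1M (is_derive_id e 1) (is_derive_cst (c z) e 1))
  (is_derive_cst (lin_form l c) e 1).
by apply: (is_derive1_eq D); rewrite mulr0 mul1r !addr0.
Qed.

End LinearForm.

(** * State integrals of the model and their derivatives *)

Section Model.
Context {R : realType} {dx dz : measure_display}.
Context {X : measurableType dx} {Y : measurableType dz}.
Context {mu : {measure set X -> \bar R}} {nu : {measure set Y -> \bar R}}.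
Variables (M : et_model mu nu) (Z : {fset Y}).
Implicit Types (l : seq (R * Z)) (V W : {set Z}) (x : X).

(** The atoms are indexed by the finite type [Z], so that sets of directions are elements of
    [{set Z}] and can be partitioned. *)
Definition delta_comb l : gfun R Y :=
  GFun (fun=> 0) [seq (p.1, val p.2) | p <- l].

Definition FA_weight (z : Z) : R := pFA M (val z).
Definition meas_weight x (z : Z) : R := pz M x (val z).

Lemma gint_delta_comb l (p : Y -> R) :
  gint nu (delta_comb l) p = lin_form l (fun z => p (val z)).
Proof.
rewrite /gint /lin_form /= big_map; under eq_Rintegral do rewrite mul0r.
by rewrite Rintegral_cst // mul0r add0r.
Qed.

Lemma set_gint_iid_cluster l P (p : Y -> R) :
  set_gint nu (delta_comb l) (iid_cluster P p) = pgf P (lin_form l (fun z => p (val z))).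
Proof.
rewrite /set_gint /pgf /pseries; congr (limn (series _)); apply/funext => n.
rewrite (iter_gint_prod (c := n`!%:R * P n) (w := p)).
- by rewrite gint_delta_comb !mulrA mulVf ?mul1r // pnatr_eq0 -lt0n fact_gt0.
- under eq_fun do rewrite mul0r; exact: integrable0.
- by move=> s <-.
Qed.

Lemma pprior_ge0 x : 0 <= pprior M x.
Proof.
rewrite /pprior divr_ge0 ?Dprior_ge0 //; apply: Rintegral_ge0 => y _.
exact: Dprior_ge0.
Qed.

Lemma integrable_Dprior : mu.-integrable setT (EFin \o Dprior M).
Proof.
apply/integrableP; split; first exact/measurable_EFinP/Dprior_meas.
under eq_integral => x _ do rewrite /= ger0_norm ?Dprior_ge0 //.
by have /andP[] := Dprior_mass M.
Qed.

Lemma measurable_pprior : measurable_fun setT (pprior M).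
Proof. by apply: measurable_funM; [exact: Dprior_meas|exact: measurable_cst]. Qed.

Lemma integrable_pprior : mu.-integrable setT (EFin \o pprior M).
Proof.
have := integrableZl measurableT (\int[mu]_x Dprior M x)^-1 integrable_Dprior.
apply: eq_integrable => // x _ /=.
by rewrite -EFinM mulrC.
Qed.

Lemma pD_ge0 x : 0 <= pD M x. Proof. by have /andP[] := pD_itv M x. Qed.
Lemma pD_le1 x : pD M x <= 1. Proof. by have /andP[] := pD_itv M x. Qed.

Lemma Pz_ge0 x n : 0 <= Pz M x n. Proof. by have [] := Pz_pmf M x. Qed.

Lemma meas_weight_ge0 x z : 0 <= meas_weight x z.
Proof. by have [_ + _] := pz_pdf M x; exact. Qed.

Lemma meas_total_ge0 x : 0 <= \sum_z meas_weight x z.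
Proof. by apply: sumr_ge0 => z _; exact: meas_weight_ge0. Qed.

Lemma measurable_meas_weight z : measurable_fun setT (meas_weight ^~ z).
Proof.
have := measurableT_comp (pz_meas M) (pair2_measurable (val z)).
exact.
Qed.

Lemma qbar_ge0 : 0 <= qbar M.
Proof.
rewrite /qbar /prior_avg /gint big_nil addr0; apply: Rintegral_ge0 => x _ /=.
rewrite mul1r mulr_ge0 ?pprior_ge0 // addr_ge0 ?subr_ge0 ?pD_le1 //.
rewrite mulr_ge0 ?pD_ge0 // pgf_ge0 //; first exact: Pz_ge0.
by apply: (pmf_cvg_in_disc (Pz_pmf M x)); rewrite normr0.
Qed.

Variables (del : R) (del_gt0 : 0 < del).
Hypothesis GZ_cvg : forall x, cvgn (pseries (Pz M x) (del * \sum_z meas_weight x z)).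
Hypothesis GZ_int : mu.-integrable setT (fun x =>
  (pprior M x * (pD M x * GZ M x (del * \sum_z meas_weight x z)))%:E).

Definition meas_form l x : R := lin_form l (meas_weight x).

Lemma meas_form_le l x : l1_norm l < del / 2 ->
  `|meas_form l x| <= del / 2 * \sum_z meas_weight x z.
Proof.
move=> ldel; apply: le_trans (lin_form_le _ (meas_weight_ge0 x)) _.
by rewrite ler_wpM2r ?meas_total_ge0 // ltW.
Qed.

(** [GZ M x] is needed on an open disc around the form, whose radius may depend on [x]. *)
Lemma meas_form_disc l x : l1_norm l < del / 2 ->
  exists2 rho, `|meas_form l x| < rho & cvg_in_disc (Pz M x) rho.
Proof.
move=> ldel; have lS := meas_form_le x ldel.
(* If all weights vanish at [x], convergence at [del * 0] gives no disc; the unit disc of a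
   probability distribution is used instead. *)
have := meas_total_ge0 x; rewrite le_eqVlt => /predU1P[S0|S0].
  exists 1; last exact: pmf_cvg_in_disc (Pz_pmf M x).
  by apply: le_lt_trans lS _; rewrite -S0 mulr0.
exists `|del * \sum_z meas_weight x z|; last exact: cvg_in_disc_pseries.
apply: le_lt_trans lS _; rewrite gtr0_norm ?mulr_gt0 // ltr_pM2r //.
by have := del_gt0; lra.
Qed.

(* For [V] empty, the integrand of the argument [q] of [Gprior] in [F];
   otherwise that of the derivative of [q] in the directions [z \in V], which at
   [g = 0] is [eta_V] times the product of the [pFA z]. *)
Definition block_integrand V l x : R :=
  ((V == finset.set0)%:R * (1 - pD M x) +
   pD M x * derive1n #|V| (GZ M x) (meas_form l x) *
     \prod_(z in V) meas_weight x z) * pprior M x.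

(** The dominating function: [pprior] covers the missed-detection term, the rest is the Cauchy
    estimate of [pgf_derive_bound]. It depends on the block only through its size and not on the
    weights. *)
Definition block_dom k x : R :=
  pprior M x + k`!%:R * (2 / del) ^+ k *
    (pprior M x * (pD M x * GZ M x (del * \sum_z meas_weight x z))).

Lemma GZ_del_ge0 x : 0 <= GZ M x (del * \sum_z meas_weight x z).
Proof.
apply: pgf_ge0 => //; first exact: Pz_ge0.
by rewrite mulr_ge0 ?meas_total_ge0 // ltW.
Qed.

Lemma block_dom_ge0 k x : 0 <= block_dom k x.
Proof.
rewrite addr_ge0 ?pprior_ge0 // mulr_ge0 //.
  by rewrite mulr_ge0 // exprn_ge0 // divr_ge0 // ltW.
by rewrite mulr_ge0 ?pprior_ge0 // mulr_ge0 ?pD_ge0 ?GZ_del_ge0.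
Qed.

Lemma integrable_block_dom k : mu.-integrable setT (EFin \o block_dom k).
Proof.
have := integrableD measurableT integrable_pprior
  (integrableZl measurableT (k`!%:R * (2 / del) ^+ k) GZ_int).
by apply: eq_integrable.
Qed.

(** The product of the weights over [V] is at most the [#|V|]-th power of their total, the power
    that accompanies the derivative in [pgf_derive_bound]. *)
Lemma block_integrand_le V l x : l1_norm l < del / 2 ->
  `|block_integrand V l x| <= block_dom #|V| x.
Proof.
move=> ldel; rewrite /block_integrand normrM (ger0_norm (pprior_ge0 x)).
have [rho srho crho] := meas_form_disc x ldel.
have bnd := pgf_derive_bound (Pz_ge0 x) del_gt0 (meas_total_ge0 x) (@GZ_cvg x)
  (meas_form_le x ldel) (iter_pseries_diffs_cvg_in_disc (k := #|V|) crho srho).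
rewrite (derive1n_pgf _ crho srho).
have prodS : `|\prod_(z in V) meas_weight x z| <= (\sum_z meas_weight x z) ^+ #|V|.
  rewrite normr_prod -prodr_const. apply: ler_prod => z _.
  rewrite normr_ge0 ger0_norm ?meas_weight_ge0 //=.
  by rewrite (bigD1 z) //= lerDl sumr_ge0 // => ? _; exact: meas_weight_ge0.
rewrite /block_dom.
have -> : forall c p D g : R, p + c * (p * (D * g)) = (1 + D * (c * g)) * p by move=> *; ring.
rewrite ler_wpM2r ?pprior_ge0 // (le_trans (ler_normD _ _)) // lerD //.
  rewrite normrM normr_nat ger0_norm ?subr_ge0 ?pD_le1 //.
  have := pD_ge0 x; have := pD_le1 x; case: (V == _) => /=; lra.
rewrite !normrM (ger0_norm (pD_ge0 x)) -mulrA ler_wpM2l ?pD_ge0 //.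
by apply: le_trans bnd; rewrite ler_wpM2l.
Qed.

Lemma measurable_meas_form l : measurable_fun setT (meas_form l).
Proof.
apply: measurable_sum => p; apply: measurable_funM => //.
exact: measurable_meas_weight.
Qed.

Lemma measurable_block_integrand V l : l1_norm l < del / 2 ->
  measurable_fun setT (block_integrand V l).
Proof.
move=> ldel; apply: measurable_funM; last exact: measurable_pprior.
apply: measurable_funD.
  apply: measurable_funM; first exact: measurable_cst.
  by apply: measurable_funB; [exact: measurable_cst|exact: pD_meas].
apply: measurable_funM; last first.
  have -> : (fun x => \prod_(z in V) meas_weight x z) =
      (fun x => \prod_(z <- enum V) meas_weight x z).
    by apply/funext => x; rewrite big_enum.
  by apply: measurable_prod => z _; exact: measurable_meas_weight.
apply: measurable_funM; first exact: pD_meas.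
have -> : (fun x => derive1n #|V| (GZ M x) (meas_form l x)) =
    (fun x => pgf (iter #|V| (@pseries_diffs R) (Pz M x)) (meas_form l x)).
  apply/funext => x; have [rho srho crho] := meas_form_disc x ldel.
  exact: derive1n_pgf srho.
apply: measurable_pgf; [exact: Pz_meas|exact: measurable_meas_form|].
move=> x; have [rho srho crho] := meas_form_disc x ldel.
exact: iter_pseries_diffs_cvg_in_disc srho.
Qed.

Lemma integrable_block_integrand V l : l1_norm l < del / 2 ->
  mu.-integrable setT (EFin \o block_integrand V l).
Proof.
move=> ldel; apply: le_integrable (integrable_block_dom #|V|) => //.
  exact/measurable_EFinP/measurable_block_integrand.
move=> x _ /=; rewrite lee_fin (ger0_norm (block_dom_ge0 _ _)).
exact: block_integrand_le.
Qed.

(** The chain rule raises the order of the derivative of [GZ] and produces the factor of [z]; the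
    term [1 - pD] is constant and [z |: V] is nonempty. *)
Lemma is_derive1_block_integrand V l z (e : R) x : z \notin V ->
  l1_norm ((e, z) :: l) < del / 2 ->
  is_derive e 1 (fun e => block_integrand V ((e, z) :: l) x)
    (block_integrand (z |: V)%SET ((e, z) :: l) x).
Proof.
move=> zV ldel; have [rho srho crho] := meas_form_disc x ldel.
have sGZ := smooth_on_derive1n #|V| (smooth_on_pgf crho).
have dGZ := smooth_on_is_derive sGZ srho.
have dlin : is_derive e 1 (fun e => meas_form ((e, z) :: l) x) (meas_weight x z).
  exact: is_derive1_lin_form.
have dcomp := is_derive1_comp_fun dGZ dlin.
have D := is_derive1M (is_derive1D
    (is_derive_cst ((V == finset.set0)%:R * (1 - pD M x)) e 1)
    (is_derive1M (is_derive1M (is_derive_cst (pD M x) e 1) dcomp)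
      (is_derive_cst (\prod_(z in V) meas_weight x z) e 1)))
  (is_derive_cst (pprior M x) e 1).
apply: (is_derive1_eq D).
have zV0 : (z |: V)%SET == finset.set0 = false.
  by apply/negbTE/finset.set0Pn; exists z; rewrite finset.setU11.
rewrite /block_integrand zV0 cardsU1 zV add1n big_setU1 // [derive1n #|V|.+1 _]derive1nS /=.
by rewrite /GZ; ring.
Qed.

Definition block_gint (h : gfun R X) V l : R := gint mu h (block_integrand V l).

Lemma block_integrand0 V z l : block_integrand V ((0, z) :: l) = block_integrand V l.
Proof. by apply/funext => x; rewrite /block_integrand /meas_form lin_form0. Qed.

Lemma is_derive1_block_gint (y : R) (at_ : seq (R * X)) V l z : z \notin V ->
  l1_norm l < del / 2 ->
  is_derive (0 : R) 1 (fun e => block_gint (GFun (fun=> y) at_) V ((e, z) :: l))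
    (block_gint (GFun (fun=> y) at_) (z |: V)%SET l).
Proof.
move=> zV ldel; rewrite /block_gint /gint /=.
have ldel0 : l1_norm ((0, z) :: l) < del / 2 by rewrite l1_norm_cons normr0 add0r.
apply: is_derive1D; last first.
  apply: is_derive1_sum => p _.
  have D := is_derive1M (is_derive_cst p.1 (0 : R) 1)
    (is_derive1_block_integrand p.2 zV ldel0).
  by apply: (is_derive1_eq D); rewrite mul0r add0r block_integrand0.
(* The slack in the norm bound is the half-width of an interval of [e] on which all estimates hold
   uniformly. *)
pose eta := del / 2 - l1_norm l; have eta0 : 0 < eta by rewrite subr_gt0.
pose I : set R := [set` `]-eta, eta[].
pose f e x := y * block_integrand V ((e, z) :: l) x.
have etaP e : I e -> l1_norm ((e, z) :: l) < del / 2.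
  rewrite /I /= in_itv /= => eeta; rewrite l1_norm_cons -ltrBrDr ltr_norml.
  by rewrite eeta.
have I0 : I 0 by rewrite /I /= in_itv /= oppr_lt0 eta0.
have df e x : I e ->
    is_derive e 1 (f ^~ x) (y * block_integrand (z |: V)%SET ((e, z) :: l) x).
  move=> /etaP le.
  have D := is_derive1M (is_derive_cst y e 1) (is_derive1_block_integrand x zV le).
  by apply: (is_derive1_eq D); rewrite mul0r add0r.
have d1f e x : I e ->
    partial1of2 f e x = y * block_integrand (z |: V)%SET ((e, z) :: l) x.
  by move=> /df dfe; rewrite /partial1of2; exact: is_derive1E.
have intf e : I e -> mu.-integrable setT (EFin \o f e).
  move=> /etaP le.
  have := integrableZl measurableT y (integrable_block_integrand V le).
  by apply: eq_integrable.
have derf e x : I e -> setT x -> derivable (f ^~ x) e 1.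
  by move=> /(df _ x)[].
have G0 x : 0 <= `|y| * block_dom #|(z |: V)%SET| x by rewrite mulr_ge0 // block_dom_ge0.
have iG : mu.-integrable setT (EFin \o (fun x => `|y| * block_dom #|(z |: V)%SET| x)).
  have := integrableZl measurableT `|y| (integrable_block_dom #|(z |: V)%SET|).
  by apply: eq_integrable.
have Gub e x : I e -> setT x ->
    `|partial1of2 f e x| <= `|y| * block_dom #|(z |: V)%SET| x.
  move=> Ie _; rewrite d1f // normrM ler_wpM2l //.
  by apply: block_integrand_le; exact: etaP.
have dI := derivable_under_integral measurableT I0 intf derf G0 iG Gub.
have dIE := differentiation_under_integral measurableT I0 intf derf G0 iG Gub.
apply: DeriveDef; first exact: dI.
rewrite -derive1E [LHS]dIE; apply: eq_Rintegral => x _.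
by rewrite d1f // block_integrand0.
Qed.

(** For fixed [n] the iterated integral is the false alarm factor times [n! Pprior(n) q^n]; dividing
    by [n!] and summing gives [Gprior] at [q]. *)
Lemma jointF_delta_comb (y r : R) (at_ : seq (R * X)) l : l1_norm l < del / 2 ->
  cvgn (pseries (Pprior M) r) ->
  `|block_gint (GFun (fun=> y) at_) finset.set0 l| < `|r| ->
  jointF M (delta_comb l) (GFun (fun=> y) at_) =
  GFA M (lin_form l FA_weight) * Gprior M (block_gint (GFun (fun=> y) at_) finset.set0 l).
Proof.
move=> ldel cr qr; set h := GFun _ _; set q := block_gint _ _ _ in qr *.
have cq : cvgn (pseries (Pprior M) q) by exact: is_cvg_pseries_inside cr qr.
rewrite /jointF /set_gint.
have -> : (fun n => (n`!%:R)^-1 * iter_gint mu h n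
     (fun s => Gmeas M (delta_comb l) s * iid_cluster (Pprior M) (pprior M) s)) =
   GFA M (lin_form l FA_weight) *: (fun n => Pprior M n * q ^+ n).
  apply/funext => n.
  rewrite (iter_gint_prod (c := GFA M (lin_form l FA_weight) * (n`!%:R * Pprior M n))
             (w := block_integrand finset.set0 l)).
  - rewrite -[gint _ _ _]/q -[RHS]/(_ * (_ * _)); field.
    by rewrite pnatr_eq0 -lt0n fact_gt0.
  - have := integrableZl measurableT y (integrable_block_integrand finset.set0 ldel).
    by apply: eq_integrable.
  - move=> s sn; rewrite /Gmeas /iid_cluster sn /GFA_fun set_gint_iid_cluster.
    have -> : \prod_(t <- s) block_integrand finset.set0 l t =
        \prod_(x <- s) (1 - pD M x + pD M x * GZ_fun M (delta_comb l) x) *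
        \prod_(x <- s) pprior M x.
      rewrite -big_split /=; apply: eq_bigr => x _.
      rewrite /block_integrand eqxx cards0 big_set0 mul1r mulr1.
      by rewrite /GZ_fun set_gint_iid_cluster.
    rewrite /GFA /FA_weight; ring.
by rewrite lim_seriesZ.
Qed.

End Model.

(** * Iterated derivatives of the joint functional *)

Section Corrector.
Context {R : realType} {dx dz : measure_display}.
Context {X : measurableType dx} {Y : measurableType dz}.
Context {mu : {measure set X -> \bar R}} {nu : {measure set Y -> \bar R}}.
Variables (M : et_model mu nu) (Z : {fset Y}).
Implicit Types (l : seq (R * Z)) (V W : {set Z}) (P Q : {set {set Z}}) (x : X).

Variables (del : R) (del_gt0 : 0 < del).
Hypothesis GZ_cvg : forall x,
  cvgn (pseries (Pz M x) (del * \sum_(z : Z) meas_weight M x z)).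
Hypothesis GZ_int : mu.-integrable setT (fun x =>
  (pprior M x * (pD M x * GZ M x (del * \sum_(z : Z) meas_weight M x z)))%:E).
Variables (r : R) (Pr_cvg : cvgn (pseries (Pprior M) r)).

Lemma smooth_on_GFA : smooth_on [set s | `|s| < 1] (GFA M).
Proof. exact/smooth_on_pgf/pmf_cvg_in_disc/PFA_pmf. Qed.

Lemma smooth_on_Gprior : smooth_on [set s | `|s| < `|r|] (Gprior M).
Proof. exact/smooth_on_pgf/cvg_in_disc_pseries. Qed.

Section FixedTestFunction.
Variables (y : R) (ats : seq (R * X)).
Let h : gfun R X := GFun (fun=> y) ats.
Let q V l := block_gint (mu := mu) M h V l.
Let q0 l := q finset.set0 l.
Let A l := lin_form l (FA_weight M (Z := Z)).

Definition joint_value l : R := GFA M (A l) * Gprior M (q0 l).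

(* The iterated derivative of [log F] in the directions [z \in W], for [W]
   nonempty, written without logarithms. *)
Definition block_factor W l : R :=
  zetaFA M #|W| (A l) * \prod_(z in W) FA_weight M z +
  partition_sum (fun k => zeta M k (q0 l)) (q ^~ l) W.

(** The arguments lie inside the discs of convergence and the denominators of the logarithmic
    derivatives are nonzero. *)
Definition regular_point l : Prop :=
  [/\ l1_norm l < del / 2, `|A l| < 1, GFA M (A l) != 0,
      `|q0 l| < `|r| & Gprior M (q0 l) != 0].

Lemma is_derive1_FA_form l z :
  is_derive (0 : R) 1 (fun e => A ((e, z) :: l)) (FA_weight M z).
Proof. exact: is_derive1_lin_form. Qed.

Lemma is_derive1_block_gint_cons V l z : z \notin V -> l1_norm l < del / 2 ->
  is_derive (0 : R) 1 (fun e => q V ((e, z) :: l)) (q (z |: V)%SET l).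
Proof. by move=> zV ldel; exact: (is_derive1_block_gint (del := del)). Qed.

Lemma is_derive1_block_gint_set0 l z : l1_norm l < del / 2 ->
  is_derive (0 : R) 1 (fun e => q0 ((e, z) :: l)) (q [set z]%SET l).
Proof.
move=> ldel; rewrite -[[set z]%SET]finset.setU0.
by apply: is_derive1_block_gint_cons; rewrite ?finset.in_set0.
Qed.

Lemma FA_form_cons0 z l : A ((0, z) :: l) = A l.
Proof. exact: lin_form0. Qed.

Lemma block_gint_cons0 V z l : q V ((0, z) :: l) = q V l.
Proof. by rewrite /q /block_gint block_integrand0. Qed.

(** The inner value is given by an equation, because forms at [(0, z) :: l] and at [l] are equal but
    not convertible. *)
Lemma is_derive1_comp_at f g (a b df dg : R) : g a = b -> is_derive b 1 f df ->
  is_derive a 1 g dg -> is_derive a 1 (fun e => f (g e)) (df * dg).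
Proof. by move=> <-; exact: is_derive1_comp_fun. Qed.

Lemma is_derive1_GFA l z : regular_point l ->
  is_derive (0 : R) 1 (fun e => GFA M (A ((e, z) :: l)))
    (derive1 (GFA M) (A l) * FA_weight M z).
Proof.
move=> [_ A1 _ _ _]; apply: is_derive1_comp_at (is_derive1_FA_form l z).
  exact: FA_form_cons0.
exact: smooth_on_is_derive smooth_on_GFA A1.
Qed.

Lemma is_derive1_Gprior l z : regular_point l ->
  is_derive (0 : R) 1 (fun e => Gprior M (q0 ((e, z) :: l)))
    (derive1 (Gprior M) (q0 l) * q [set z]%SET l).
Proof.
move=> [ldel _ _ qr _]; apply: is_derive1_comp_at (is_derive1_block_gint_set0 z ldel).
  exact: block_gint_cons0.
exact: smooth_on_is_derive smooth_on_Gprior qr.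
Qed.

Lemma is_derive1_zetaFA i l z : (0 < i)%N -> regular_point l ->
  is_derive (0 : R) 1 (fun e => zetaFA M i (A ((e, z) :: l)))
    (zetaFA M i.+1 (A l) * FA_weight M z).
Proof.
move=> i0 [_ A1 GA _ _]; apply: is_derive1_comp_at (is_derive1_FA_form l z).
  exact: FA_form_cons0.
by apply: (is_derive1_logderiv _ smooth_on_GFA) => //; exact: open_disc.
Qed.

Lemma is_derive1_zeta i l z : (0 < i)%N -> regular_point l ->
  is_derive (0 : R) 1 (fun e => zeta M i (q0 ((e, z) :: l)))
    (zeta M i.+1 (q0 l) * q [set z]%SET l).
Proof.
move=> i0 [ldel _ _ qr Gq]; apply: is_derive1_comp_at (is_derive1_block_gint_set0 z ldel).
  exact: block_gint_cons0.
by apply: (is_derive1_logderiv _ smooth_on_Gprior) => //; exact: open_disc.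
Qed.

Lemma partition_card_gt0 W Q : W != finset.set0 -> finset.partition Q W -> (0 < #|Q|)%N.
Proof.
move=> W0 QW; rewrite card_gt0; apply: contraNneq W0 => Q0.
by rewrite -(cover_partition QW) Q0 /finset.cover big_set0.
Qed.

(** The false alarm term gains one order and one weight; for the other term the product rule is
    [partition_sumU1]. *)
Lemma is_derive1_block_factor W l z : z \notin W -> W != finset.set0 ->
  regular_point l ->
  is_derive (0 : R) 1 (fun e => block_factor W ((e, z) :: l))
    (block_factor (z |: W)%SET l).
Proof.
move=> zW W0 gl; have [ldel _ _ _ _] := gl.
have D1 := is_derive1M (is_derive1_zetaFA (i := #|W|) z _ gl)
  (is_derive_cst (\prod_(z in W) FA_weight M z) (0 : R) 1).
have D2 := is_derive1_partition_sum (A := W)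
  (c := fun k e => zeta M k (q0 ((e, z) :: l)))
  (dc := fun k => zeta M k.+1 (q0 l) * q [set z]%SET l)
  (u := fun V e => q V ((e, z) :: l)) (du := fun V => q (z |: V)%SET l) (x := 0).
apply: (is_derive1_eq (is_derive1D (D1 _) (D2 _ _))).
- by rewrite card_gt0.
- by move=> Q QW; apply: is_derive1_zeta => //; exact: partition_card_gt0 QW.
- move=> V _ VW; apply: is_derive1_block_gint_cons => //.
  by apply: contra zW; exact: (fintype.subsetP VW).
rewrite /block_factor cardsU1 zW add1n big_setU1 //= partition_sumU1 //.
rewrite mulr0 addr0 mulrA; congr (_ + _).
apply: eq_bigr => Q QW; rewrite /q0 !block_gint_cons0; congr (_ * _ + _ * _).
  by apply: eq_bigr => V _; rewrite block_gint_cons0.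
apply: eq_bigr => V _; congr (_ * _).
by apply: eq_bigr => V' _; rewrite block_gint_cons0.
Qed.

Lemma is_derive1_joint_value l z : regular_point l ->
  is_derive (0 : R) 1 (fun e => joint_value ((e, z) :: l))
    (joint_value l * block_factor [set z]%SET l).
Proof.
move=> gl; have [_ _ GA _ Gq] := gl.
apply: (is_derive1_eq (is_derive1M (is_derive1_GFA z gl) (is_derive1_Gprior z gl))).
rewrite /joint_value /block_factor partition_sum1 cards1 big_set1 FA_form_cons0 /q0 block_gint_cons0.
rewrite /zetaFA /zeta /logderiv /= -/(q0 l).
by field; rewrite GA Gq.
Qed.

(** An outer derivative at 0 needs the formula for the inner derivatives on a whole neighbourhood of
    0. *)
Lemma regular_point_near l z : regular_point l ->
  \forall e \near (0 : R), regular_point ((e, z) :: l).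
Proof.
move=> gl; have [ldel A1 GA qr Gq] := gl.
have cA := is_derive1_cvg (is_derive1_FA_form l z); rewrite FA_form_cons0 in cA.
have cq := is_derive1_cvg (is_derive1_block_gint_set0 z ldel); rewrite /q0 block_gint_cons0 in cq.
have cGA := is_derive1_cvg (is_derive1_GFA z gl); rewrite FA_form_cons0 in cGA.
have cGq := is_derive1_cvg (is_derive1_Gprior z gl); rewrite /q0 block_gint_cons0 in cGq.
near=> e; split.
- rewrite l1_norm_cons -ltrBrDr; near: e.
  have d0 : 0 < del / 2 - l1_norm l by rewrite subr_gt0.
  by apply: (@cvgr0_norm_lt _ _ _ _ _ (fun e : R => e)) d0; exact: cvg_id.
- by near: e; apply: (cvgr_norm_lt _ cA).
- by near: e; apply: (cvgr_neq0 _ cGA).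
- by near: e; apply: (cvgr_norm_lt _ cq).
- by near: e; apply: (cvgr_neq0 _ cGq).
Unshelve. all: by end_near. Qed.

(** The list [l] is generalized in the induction: [fderiv] differentiates last in the head
    direction, so the induction hypothesis is applied at [(e, z) :: l] for small [e]. *)
Lemma fderiv_jointF (s : seq Z) l : uniq s -> regular_point l ->
  fderiv (fun g => jointF M g h) (map val s) (delta_comb l) =
  joint_value l * partition_sum (fun=> 1) (block_factor ^~ l) [set z in s]%SET.
Proof.
elim: s l => [|z s IHs] l /=.
  move=> _ [ldel _ _ qr _]; rewrite (jointF_delta_comb del_gt0 GZ_cvg GZ_int _ Pr_cvg) //.
  have -> : [set z in [::]]%SET = finset.set0 :> {set Z}.
    by apply/setP => z; rewrite !inE.
  by rewrite partition_sum0 mulr1.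
move=> /andP[zs us] gl; have zs' : z \notin [set z in s]%SET by rewrite inE.
have -> : [set z0 in z :: s]%SET = (z |: [set z0 in s])%SET.
  by apply/setP => t; rewrite !inE.
apply: is_derive1E.
apply: (@near_eq_is_derive1 _ _ (fun e => joint_value ((e, z) :: l) *
    partition_sum (fun=> 1) (block_factor ^~ ((e, z) :: l)) [set z in s]%SET)).
  near=> e; rewrite -IHs //; near: e; exact: regular_point_near.
have D := is_derive1_partition_sum (A := [set z in s]%SET)
  (c := fun k e => 1) (dc := fun k => 0)
  (u := fun W e => block_factor W ((e, z) :: l))
  (du := fun W => block_factor (z |: W)%SET l) (x := 0).
have cons0 W : block_factor W ((0, z) :: l) = block_factor W l.
  rewrite /block_factor FA_form_cons0 /q0 block_gint_cons0; congr (_ + _).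
  by apply: eq_bigr => Q _; congr (_ * _); apply: eq_bigr => V _; rewrite block_gint_cons0.
apply: (is_derive1_eq (is_derive1M (is_derive1_joint_value z gl) (D _ _))).
  move=> W W0 Ws; apply: is_derive1_block_factor => //.
  by apply: contra zs'; exact: (fintype.subsetP Ws).
have -> : joint_value ((0, z) :: l) = joint_value l.
  by rewrite /joint_value FA_form_cons0 /q0 block_gint_cons0.
(* Differentiating [joint_value] makes [{z}] a new block; differentiating a factor puts [z] into
   that block. *)
rewrite partition_sumU1 // -mulrA -mulrDr; congr (_ * _).
rewrite /partition_sum mulr_sumr -big_split /=; apply: eq_bigr => P _.
rewrite mul0r add0r !mul1r; congr (_ * _ + _).
  by apply: eq_bigr => W _; rewrite cons0.
apply: eq_bigr => W _.
by congr (_ * _); apply: eq_bigr => W' _; rewrite cons0.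
Unshelve. all: by end_near. Qed.

Lemma dF_regular : GFA M 0 != 0 -> `|q0 [::]| < `|r| -> Gprior M (q0 [::]) != 0 ->
  dF M Z h = GFA M 0 * Gprior M (q0 [::]) *
    partition_sum (fun=> 1) (block_factor ^~ [::]) [set: Z]%SET.
Proof.
move=> GA qr Gq.
have A0 : A [::] = 0 by rewrite /A /lin_form big_nil.
have g0 : regular_point [::].
  split; rewrite ?A0 ?normr0 //.
  by rewrite /l1_norm big_nil divr_gt0.
rewrite /dF enum_fsetE.
have := fderiv_jointF (enum_uniq _) g0.
rewrite /delta_comb /= => ->; rewrite /joint_value A0; congr (_ * partition_sum _ _ _).
by apply/setP => z; rewrite !inE mem_enum.
Qed.

End FixedTestFunction.
End Corrector.

(** * The corrector formulas *)

Section Conclusion.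
Context {R : realType} {dx dz : measure_display}.
Context {X : measurableType dx} {Y : measurableType dz}.
Context {mu : {measure set X -> \bar R}} {nu : {measure set Y -> \bar R}}.
Variables (M : et_model mu nu) (Z : {fset Y}).
Implicit Types (V W : {set Z}) (P Q : {set {set Z}}) (x : X).

Variables (del : R) (del_gt0 : 0 < del).
Hypothesis GZ_cvg : forall x,
  cvgn (pseries (Pz M x) (del * \sum_(z : Z) meas_weight M x z)).
Hypothesis GZ_int : mu.-integrable setT (fun x =>
  (pprior M x * (pD M x * GZ M x (del * \sum_(z : Z) meas_weight M x z)))%:E).
Variables (r : R) (Pr_cvg : cvgn (pseries (Pprior M) r)).
Hypothesis FA_neq0 : forall z : Z, FA_weight M z != 0.

(** The conversion factor between block integrals and [eta], which is normalized by [pFA]. Being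
    multiplicative over partitions, it comes out of all sums and cancels in the posterior
    quotients. *)
Definition FA_prod W : R := \prod_(z in W) FA_weight M z.

Lemma FA_prod_neq0 W : FA_prod W != 0.
Proof. by apply/prodf_neq0 => z _; exact: FA_neq0. Qed.

Lemma FA_prod_partition Q W : finset.partition Q W ->
  \prod_(V in Q) FA_prod V = FA_prod W.
Proof.
move=> QW; rewrite /FA_prod.
by rewrite -(set_partition_big _ QW).
Qed.

Let l1_norm_nil : @l1_norm R Z [::] < del / 2.
Proof. by rewrite /l1_norm big_nil divr_gt0. Qed.

Lemma block_gintE (y : R) (ats : seq (R * X)) V :
  block_gint (mu := mu) M (GFun (fun=> y) ats) V [::] =
  y * block_gint (mu := mu) M (gcst X 1) V [::] +
  \sum_(a <- ats) a.1 * block_integrand M V [::] a.2.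
Proof.
rewrite /block_gint /gint /= big_nil addr0; congr (_ + _).
under [in RHS]eq_Rintegral do rewrite mul1r.
rewrite -RintegralZl //.
exact: (integrable_block_integrand del_gt0 GZ_cvg GZ_int).
Qed.

Lemma block_gint_set0 : block_gint (mu := mu) M (gcst X 1) (finset.set0 : {set Z}) [::] = qbar M.
Proof.
rewrite /block_gint /qbar /prior_avg; congr gint; apply/funext => x.
rewrite /block_integrand eqxx cards0 big_set0 mul1r mulr1 /meas_form.
by rewrite /lin_form big_nil.
Qed.

Lemma gint_gcst0 (p : Y -> R) : gint nu (gcst Y 0) p = 0.
Proof.
have := gint_delta_comb (nu := nu) (Z := Z) [::] p.
by rewrite [lin_form _ _]big_nil.
Qed.

Lemma block_gint_eta V : V != finset.set0 ->
  block_gint (mu := mu) M (gcst X 1) V [::] = FA_prod V * eta01 M V.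
Proof.
move=> V0; rewrite /eta01 /eta /prior_avg -gintZ.
  rewrite /block_gint; congr gint; apply/funext => x.
  rewrite /block_integrand (negPf V0) mul0r add0r.
  rewrite gint_gcst0.
  rewrite prodf_div /FA_prod /meas_form /=.
  rewrite [lin_form _ _]big_nil.
  rewrite /FA_weight /meas_weight; field; exact: FA_prod_neq0.
have := integrableZl measurableT (FA_prod V)^-1
  (integrable_block_integrand del_gt0 GZ_cvg GZ_int V l1_norm_nil).
apply: eq_integrable => // x _ /=; rewrite -EFinM mul1r; congr EFin.
rewrite /block_integrand (negPf V0) mul0r add0r.
rewrite gint_gcst0.
rewrite prodf_div /FA_prod /meas_form /=.
rewrite [lin_form _ _]big_nil.
by rewrite /FA_weight /meas_weight; field; exact: FA_prod_neq0.
Qed.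

Lemma alpha_block_gint Q W : finset.partition Q W ->
  \prod_(V in Q) block_gint (mu := mu) M (gcst X 1) V [::] = FA_prod W * alpha M Q.
Proof.
move=> QW; rewrite -(FA_prod_partition QW) /alpha -big_split /=.
by apply: eq_bigr => V VQ; apply: block_gint_eta; exact: partition_neq0 QW VQ.
Qed.

(** Block integrals are linear in the test function, so a constant [y] contributes one factor per
    block of [Q]. *)
Lemma block_factorE (y : R) W :
  block_factor (mu := mu) M y [::] W [::] =
  FA_prod W * (zetaFA M #|W| 0 + \sum_(Q | finset.partition Q W)
    alpha M Q * y ^+ #|Q| * zeta M #|Q| (y * qbar M)).
Proof.
rewrite /block_factor [lin_form _ _]big_nil mulrDr mulrC; congr (_ + _).
rewrite mulr_sumr; apply: eq_bigr => Q QW.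
under eq_bigr do rewrite block_gintE big_nil addr0.
rewrite big_split /= prodr_const (alpha_block_gint QW).
have qE := block_gintE y [::] finset.set0.
rewrite big_nil addr0 block_gint_set0 in qE.
by rewrite qE; move: (zeta M _ _) (alpha M Q) (y ^+ _) (FA_prod W) => a b c e; ring.
Qed.

Lemma block_factor_beta W :
  block_factor (mu := mu) M 1 [::] W [::] = FA_prod W * beta M W.
Proof.
rewrite block_factorE /beta; congr (_ * (_ + _)).
by apply: eq_bigr => Q _; rewrite expr1n mulr1 mul1r mulrC.
Qed.

Lemma partition_sum_FA_prod (b : {set Z} -> R) :
  partition_sum (fun=> 1) (fun W => FA_prod W * b W) [set: Z]%SET =
  FA_prod [set: Z]%SET *
  \sum_(P | finset.partition P [set: Z]%SET) \prod_(W in P) b W.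
Proof.
rewrite /partition_sum mulr_sumr; apply: eq_bigr => P PZ.
by rewrite mul1r big_split /= (FA_prod_partition PZ).
Qed.

Lemma dF_gcst (y : R) : GFA M 0 != 0 -> `|y * qbar M| < `|r| ->
  Gprior M (y * qbar M) != 0 ->
  dF M Z (gcst X y) = GFA M 0 * Gprior M (y * qbar M) *
    (FA_prod [set: Z]%SET * \sum_(P | finset.partition P [set: Z]%SET)
      \prod_(W in P) (zetaFA M #|W| 0 + \sum_(Q | finset.partition Q W)
        alpha M Q * y ^+ #|Q| * zeta M #|Q| (y * qbar M))).
Proof.
move=> GA yr Gy; have qE := block_gintE y [::] finset.set0.
rewrite big_nil addr0 block_gint_set0 in qE.
rewrite (dF_regular del_gt0 GZ_cvg GZ_int Pr_cvg (y := y) (ats := [::])) ?qE //.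
rewrite -partition_sum_FA_prod; congr (_ * partition_sum _ _ _).
by apply/funext => W; exact: block_factorE.
Qed.

Lemma dF_gcst1 : GFA M 0 != 0 -> `|qbar M| < `|r| -> Gprior M (qbar M) != 0 ->
  dF M Z (gcst X 1) =
  GFA M 0 * Gprior M (qbar M) * (FA_prod [set: Z]%SET * beta_total M Z).
Proof.
move=> GA qr Gq; rewrite dF_gcst ?mul1r //; congr (_ * (_ * _)).
apply: eq_bigr => P _; apply: eq_bigr => W _; rewrite /beta; congr (_ + _).
by apply: eq_bigr => Q _; rewrite expr1n mulr1 mulrC.
Qed.

Lemma Gpost_formula (y : R) : GFA M 0 != 0 -> `|qbar M| < `|r| ->
  Gprior M (qbar M) != 0 -> `|y * qbar M| < `|r| -> Gprior M (y * qbar M) != 0 ->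
  Gpost M Z y = Gprior M (y * qbar M) / Gprior M (qbar M) *
    ((\sum_(P | finset.partition P [set: Z]%SET)
      \prod_(W in P) (zetaFA M #|W| 0 + \sum_(Q | finset.partition Q W)
        alpha M Q * y ^+ #|Q| * zeta M #|Q| (y * qbar M))) / beta_total M Z).
Proof.
move=> GA qr Gq yr Gy; rewrite /Gpost /Gpost_fun dF_gcst // dF_gcst1 //.
have := FA_prod_neq0 [set: Z]%SET; move: (FA_prod _) => a a0.
(* If [beta_total] is 0, both sides are 0 because the inverse of 0 is 0. *)
have [->|b0] := eqVneq (beta_total M Z) 0; first by rewrite !(invr0, mulr0).
by field; rewrite b0 a0 Gq GA.
Qed.

(** * The posterior intensity *)

Section Intensity.
Variable x : X.
Hypotheses (GA_neq0 : GFA M 0 != 0) (qbar_lt : `|qbar M| < `|r|).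
Hypothesis Gq_neq0 : Gprior M (qbar M) != 0.

Let hx (e : R) : gfun R X := GFun (fun=> 1) [:: (e, x)].
Let q V e := block_gint (mu := mu) M (hx e) V [::].
Let psi V := block_integrand M V [::] x.

Lemma block_gint_affine V e : q V e = block_gint (mu := mu) M (gcst X 1) V [::] + e * psi V.
Proof. by rewrite /q block_gintE mul1r big_seq1. Qed.

Lemma block_gint_at0 V : q V 0 = block_gint (mu := mu) M (gcst X 1) V [::].
Proof. by rewrite block_gint_affine mul0r addr0. Qed.

Lemma block_gint_set0_at0 : q finset.set0 0 = qbar M.
Proof. by rewrite block_gint_at0 block_gint_set0. Qed.

Lemma is_derive1_block_gint_intensity V : is_derive (0 : R) 1 (q V) (psi V).
Proof.
have -> : q V = (fun e => block_gint (mu := mu) M (gcst X 1) V [::] + e * psi V).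
  by apply/funext => e; exact: block_gint_affine.
have D := is_derive1D (is_derive_cst (block_gint (mu := mu) M (gcst X 1) V [::]) (0 : R) 1)
  (is_derive1M (is_derive_id (0 : R) 1) (is_derive_cst (psi V) (0 : R) 1)).
by apply: (is_derive1_eq D); rewrite mulr0 mul1r addr0 add0r.
Qed.

Lemma is_derive1_Gprior_intensity :
  is_derive (0 : R) 1 (fun e => Gprior M (q finset.set0 e))
    (derive1 (Gprior M) (qbar M) * psi finset.set0).
Proof.
apply: is_derive1_comp_at (is_derive1_block_gint_intensity _); first exact: block_gint_set0_at0.
exact: smooth_on_is_derive (smooth_on_Gprior Pr_cvg) qbar_lt.
Qed.

Lemma is_derive1_zeta_intensity i : (0 < i)%N ->
  is_derive (0 : R) 1 (fun e => zeta M i (q finset.set0 e))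
    (zeta M i.+1 (qbar M) * psi finset.set0).
Proof.
move=> i0; apply: is_derive1_comp_at (is_derive1_block_gint_intensity _); first exact: block_gint_set0_at0.
by apply: (is_derive1_logderiv _ (smooth_on_Gprior Pr_cvg)) => //; exact: open_disc.
Qed.

(** Derivative in the weight of the delta at [x]: the false alarm part is constant, the first
    summand differentiates [zeta], the second one block integral. *)
Definition block_factor_deriv W : R :=
  \sum_(Q | finset.partition Q W)
    (zeta M #|Q|.+1 (qbar M) * psi finset.set0 *
       \prod_(V in Q) block_gint (mu := mu) M (gcst X 1) V [::] +
     zeta M #|Q| (qbar M) * \sum_(V in Q) psi V *
       \prod_(V' in Q | V' != V) block_gint (mu := mu) M (gcst X 1) V' [::]).

Lemma is_derive1_block_factor_intensity W : W != finset.set0 ->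
  is_derive (0 : R) 1 (fun e => block_factor (mu := mu) M 1 [:: (e, x)] W [::])
    (block_factor_deriv W).
Proof.
move=> W0.
have D := is_derive1_partition_sum (A := W) (c := fun k e => zeta M k (q finset.set0 e))
  (dc := fun k => zeta M k.+1 (qbar M) * psi finset.set0)
  (u := q) (du := psi) (x := 0).
apply: (is_derive1_eq (is_derive1D (is_derive_cst
  (zetaFA M #|W| (lin_form [::] (FA_weight M (Z := Z))) * FA_prod W) (0 : R) 1) (D _ _))).
- by move=> Q QW; apply: is_derive1_zeta_intensity; exact: partition_card_gt0 QW.
- by move=> V _ _; exact: is_derive1_block_gint_intensity.
rewrite add0r; apply: eq_bigr => Q _; rewrite block_gint_set0_at0; congr (_ * _ + _ * _).
  by apply: eq_bigr => V _; rewrite block_gint_at0.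
apply: eq_bigr => V _; congr (_ * _).
by apply: eq_bigr => V' _; rewrite block_gint_at0.
Qed.

Lemma derive1_dF_intensity :
  derive1 (fun e => dF M Z (hx e)) 0 =
  GFA M 0 * Gprior M (qbar M) * (zeta M 1 (qbar M) * psi finset.set0 *
      (FA_prod [set: Z]%SET * beta_total M Z) +
    \sum_(P | finset.partition P [set: Z]%SET) \sum_(W in P)
      block_factor_deriv W * \prod_(W' in P | W' != W) (FA_prod W' * beta M W')).
Proof.
have at0 W : block_factor (mu := mu) M 1 [:: (0, x)] W [::] = FA_prod W * beta M W.
  rewrite -block_factor_beta /block_factor; congr (_ + _).
  apply: eq_bigr => Q _; rewrite -/(q finset.set0 0) block_gint_at0; congr (_ * _).
  by apply: eq_bigr => V _; exact: block_gint_at0.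
apply: is_derive1E.
(* The closed form of [dF] holds for small [e], by continuity of [q] and of [Gprior] along it. *)
apply: (@near_eq_is_derive1 _ _ (fun e => GFA M 0 * Gprior M (q finset.set0 e) *
   partition_sum (fun=> 1) (block_factor (mu := mu) M 1 [:: (e, x)] ^~ [::]) [set: Z]%SET)).
  have cq := is_derive1_cvg (is_derive1_block_gint_intensity finset.set0).
  have cG := is_derive1_cvg is_derive1_Gprior_intensity.
  rewrite block_gint_set0_at0 in cq cG.
  near=> e; apply: (dF_regular del_gt0 GZ_cvg GZ_int Pr_cvg) => //.
    by near: e; apply: (cvgr_norm_lt _ cq).
  by near: e; apply: (cvgr_neq0 _ cG).
have D := is_derive1_partition_sum (A := [set: Z]%SET)
  (c := fun k e => 1) (dc := fun k => 0)
  (u := fun W e => block_factor (mu := mu) M 1 [:: (e, x)] W [::])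
  (du := block_factor_deriv) (x := 0).
apply: (is_derive1_eq (is_derive1M (is_derive1M (is_derive_cst (GFA M 0) (0 : R) 1)
   is_derive1_Gprior_intensity) (D _ _))).
  by move=> W W0 _; exact: is_derive1_block_factor_intensity.
rewrite block_gint_set0_at0 mul0r add0r /= mulrDr; congr (_ + _).
  rewrite -partition_sum_FA_prod.
  have -> : (block_factor (mu := mu) M 1 [:: (0, x)])^~ [::] =
      (fun W => FA_prod W * beta M W) by apply/funext => W; exact: at0.
  rewrite /zeta /logderiv /=; move: (psi _) (partition_sum _ _ _) => p s.
  by field; exact: Gq_neq0.
congr (_ * _); apply: eq_bigr => P _; rewrite mul0r add0r mul1r.
apply: eq_bigr => W _; congr (_ * _); apply: eq_bigr => W' _; exact: at0.
Unshelve. all: by end_near. Qed.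

Hypothesis eta_neq0 : forall V, V != finset.set0 -> eta01 M V != 0.
Hypothesis beta_neq0 : forall W, W != finset.set0 -> beta M W != 0.

Lemma block_factor_derivE W : block_factor_deriv W =
  FA_prod W * (psi finset.set0 * (\sum_(Q | finset.partition Q W)
      alpha M Q * zeta M #|Q|.+1 (qbar M)) +
    \sum_(Q | finset.partition Q W) alpha M Q * zeta M #|Q| (qbar M) *
      \sum_(V in Q) psi V / (FA_prod V * eta01 M V)).
Proof.
rewrite mulrDr !mulr_sumr -big_split /=; apply: eq_bigr => Q QW.
rewrite (alpha_block_gint QW); congr (_ + _); first by ring.
rewrite !mulr_sumr; apply: eq_bigr => V VQ.
have V0 := partition_neq0 QW VQ.
(* The product over the blocks other than [V] is the full product divided by the nonzero factor of
   [V]; hence the quotients by [eta01]. *)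
have := alpha_block_gint QW; rewrite (bigD1 V) //= (block_gint_eta V0) => E.
rewrite [RHS]mulrA [FA_prod W * _]mulrA -E.
have FV0 := FA_prod_neq0 V; have eV0 := eta_neq0 V0.
move: (psi V) (zeta M _ _) (FA_prod V) (eta01 M V) (\prod_(V' in Q | _) _) FV0 eV0.
by move=> p u a b c a0 b0; field; rewrite a0 b0.
Qed.

Lemma prod_FA_beta_D1 P W : finset.partition P [set: Z]%SET -> W \in P ->
  FA_prod W * \prod_(W' in P | W' != W) (FA_prod W' * beta M W') =
  FA_prod [set: Z]%SET * (\prod_(W' in P) beta M W') / beta M W.
Proof.
move=> PZ WP; rewrite -(FA_prod_partition PZ) -big_split /= [in RHS](bigD1 W) //=.
by field; apply: beta_neq0; exact: partition_neq0 PZ WP.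
Qed.

Lemma Dpost_formula : beta_total M Z != 0 ->
  Dpost M Z x =
    (zeta M 1 (qbar M) + kappa M Z) *
      (1 - pD M x + pD M x * GZ M x 0) * pprior M x
    + (\sum_(P | finset.partition P [set: Z]%SET)
         omega M P *
         \sum_(W in P) (beta M W)^-1 *
           \sum_(Q | finset.partition Q W)
             alpha M Q * zeta M #|Q| (qbar M) *
             \sum_(V in Q)
               pD M x * derive1n #|V| (GZ M x) 0 / eta01 M V *
               \prod_(z in V) (pz M x (val z) / pFA M (val z)))
      * pprior M x.
Proof.
move=> b0; rewrite /Dpost /= -[derive1 _ _]/(derive1 (fun e => dF M Z (hx e)) 0).
rewrite derive1_dF_intensity dF_gcst1 //.
have a0 := FA_prod_neq0 [set: Z]%SET.
have psi0 : psi finset.set0 = (1 - pD M x + pD M x * GZ M x 0) * pprior M x.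
  rewrite /psi /block_integrand eqxx cards0 big_set0 mul1r mulr1 /meas_form.
  by rewrite [lin_form _ _]big_nil.
have psiE V : V != finset.set0 -> psi V / (FA_prod V * eta01 M V) =
    pD M x * derive1n #|V| (GZ M x) 0 / eta01 M V *
      \prod_(z in V) (pz M x (val z) / pFA M (val z)) * pprior M x.
  move=> V0; rewrite /psi /block_integrand (negPf V0) mul0r add0r /meas_form.
  rewrite [lin_form _ _]big_nil prodf_div /FA_prod /FA_weight /meas_weight.
  by field; rewrite eta_neq0 // FA_prod_neq0.
(* [S1] collects the terms that sum to [kappa], [S2] those of the sum over measurement cells. *)
pose S1 W := \sum_(Q | finset.partition Q W) alpha M Q * zeta M #|Q|.+1 (qbar M).
pose S2 W := \sum_(Q | finset.partition Q W) alpha M Q * zeta M #|Q| (qbar M) *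
  \sum_(V in Q) pD M x * derive1n #|V| (GZ M x) 0 / eta01 M V *
    \prod_(z in V) (pz M x (val z) / pFA M (val z)).
have -> : \sum_(P | finset.partition P [set: Z]%SET) \sum_(W in P)
    block_factor_deriv W * \prod_(W' in P | W' != W) (FA_prod W' * beta M W') =
  FA_prod [set: Z]%SET * beta_total M Z *
  (kappa M Z * psi finset.set0 + (\sum_(P | finset.partition P [set: Z]%SET)
     omega M P * \sum_(W in P) (beta M W)^-1 * S2 W) * pprior M x).
  transitivity (\sum_(P | finset.partition P [set: Z]%SET) FA_prod [set: Z]%SET *
      beta_total M Z * (omega M P * \sum_(W in P) (beta M W)^-1 *
        (S1 W * psi finset.set0 + S2 W * pprior M x))); last first.
    rewrite -mulr_sumr; congr (_ * _); rewrite /kappa mulr_suml mulr_suml -big_split /=.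
    apply: eq_bigr => P _; rewrite -[X in _ = X + _]mulrA -[X in _ = _ + X]mulrA -mulrDr.
    congr (_ * _).
    rewrite mulr_suml mulr_suml -[RHS]big_split /=; apply: eq_bigr => W _.
    by rewrite mulrDr; congr (_ + _); rewrite mulrA.
  apply: eq_bigr => P PZ; rewrite [X in _ = _ * X]mulr_sumr [RHS]mulr_sumr.
  apply: eq_bigr => W WP.
  rewrite block_factor_derivE /omega.
  have -> : \sum_(Q | finset.partition Q W) alpha M Q * zeta M #|Q| (qbar M) *
      (\sum_(V in Q) psi V / (FA_prod V * eta01 M V)) = S2 W * pprior M x.
    rewrite /S2 mulr_suml; apply: eq_bigr => Q QW; rewrite -[RHS]mulrA [X in _ = _ * X]mulr_suml.
    congr (_ * _); apply: eq_bigr => V VQ; apply: psiE.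
    exact: partition_neq0 QW VQ.
  rewrite [LHS]mulrAC (prod_FA_beta_D1 PZ WP) -/(S1 W).
  have bW := beta_neq0 (partition_neq0 PZ WP).
  move: (S1 W) (S2 W) (psi _) (pprior M x) (FA_prod _) (beta M W) bW.
  move: (beta_total M Z) b0 (\prod_(W' in P) _) => t t0 B s1 s2 p q0 f b bW.
  by field; rewrite t0 bW.
rewrite -[(_ + kappa M Z) * _ * _]mulrA -psi0.
rewrite -/(S2 _); move: (\sum_(P | _) omega M P * _) => s2.
move: (psi _) (zeta _ _ _) (kappa _ _) (pprior M x) (beta_total _ _) b0 => p u k q0 t t0.
move: (FA_prod _) a0 (GFA M 0) GA_neq0 (Gprior M _) Gq_neq0 => a a0 ga ga0 gq gq0.
by field; rewrite a0 t0 gq0 ga0.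
Qed.

End Intensity.
End Conclusion.

Theorem mainTheorem2 (R : realType) (dx dz : measure_display)
    (X : measurableType dx) (Y : measurableType dz)
    (mu : {measure set X -> \bar R}) (nu : {measure set Y -> \bar R})
    (M : et_model mu nu) (Z : {fset Y})
    (* convergence near the points where derivatives are taken *)
    (r : R) (hr : qbar M < r) (hPr : cvgn (pseries (Pprior M) r))
    (del : R) (hdel : 0 < del)
    (hGZ : forall x : X, cvgn (pseries (Pz M x) (del * \sum_(z : Z) pz M x (val z))))
    (hint : mu.-integrable setT (fun x : X =>
       (pprior M x * (pD M x * GZ M x (del * \sum_(z : Z) pz M x (val z))))%:E))
    (* nonvanishing denominators *)
    (hFA0 : GFA M 0 != 0)
    (hpFA : forall z : Z, pFA M (val z) != 0)
    (hGq : Gprior M (qbar M) != 0)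
    (hdF : dF M Z (gcst X 1) != 0) :
  ((forall V : {set Z}, V != finset.set0 -> eta01 M V != 0) ->
   (forall W : {set Z}, W != finset.set0 -> beta M W != 0) ->
   forall x : X,
     Dpost M Z x =
       (zeta M 1 (qbar M) + kappa M Z) *
         (1 - pD M x + pD M x * GZ M x 0) * pprior M x
       + (\sum_(P : {set {set Z}} | finset.partition P [set: Z]%SET)
            omega M P *
            \sum_(W in P) (beta M W)^-1 *
              \sum_(Q : {set {set Z}} | finset.partition Q W)
                alpha M Q * zeta M #|Q| (qbar M) *
                \sum_(V in Q)
                  pD M x * derive1n #|V| (GZ M x) 0 / eta01 M V *
                  \prod_(z in V) (pz M x (val z) / pFA M (val z)))
         * pprior M x)
  /\
  (forall y : R, `|y * qbar M| < r -> Gprior M (y * qbar M) != 0 ->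
     Gpost M Z y =
       Gprior M (y * qbar M) / Gprior M (qbar M) *
       ((\sum_(P : {set {set Z}} | finset.partition P [set: Z]%SET)
           \prod_(W in P)
             (zetaFA M #|W| 0 +
              \sum_(Q : {set {set Z}} | finset.partition Q W)
                alpha M Q * y ^+ #|Q| * zeta M #|Q| (y * qbar M)))
        / \sum_(P : {set {set Z}} | finset.partition P [set: Z]%SET)
            \prod_(W in P) beta M W)).
Proof.
have hr0 : 0 <= r by apply: ltW (le_lt_trans (qbar_ge0 M) hr).
have hq : `|qbar M| < `|r| by rewrite !ger0_norm // qbar_ge0.
split=> [heta hbeta x|y hy hGy]; last first.
  apply: (Gpost_formula hdel hGZ hint hPr hpFA) => //.
  by rewrite (ger0_norm hr0).
apply: (Dpost_formula hdel hGZ hint hPr hpFA) => //.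
(* [dF] at the constant 1 is a multiple of [beta_total], so its nonvanishing carries over to
   [beta_total]. *)
apply: contraNneq hdF => b0.
by rewrite (dF_gcst1 hdel hGZ hint hPr hpFA) // b0 !mulr0.
Qed.
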